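(* The set $\mathrm D_Q$ of all pairs $\langle t,u\rangle$ of $L_Q$-terms such that $Q+\exists\vec x\,t(\vec x)=u(\vec x)$ is consistent (equivalently, such that the Diophantine equation $t(\vec x)=u(\vec x)$ has a solution in some model of Robinson's arithmetic $Q$) is decidable.
   Context: $L_Q=\langle 0,S,+,\cdot\rangle$ is the basic language of arithmetic ($0$ a constant, $S$ unary, $+$ and $\cdot$ binary function symbols), in classical first-order logic with equality. Robinson's arithmetic $Q$ is the $L_Q$-theory with axioms (universally closed): (Q1) $Sx\ne0$; (Q2) $Sx=Sy\to x=y$; (Q3) $x=0\lor\exists y\,Sy=x$; (Q4) $x+0=x$; (Q5) $x+Sy=S(x+y)$; (Q6) $x\cdot0=0$; (Q7) $x\cdot Sy=x\cdot y+x$. A Diophantine equation is a formula $t(\vec x)=u(\vec x)$ where $t,u$ are $L_Q$-terms. *)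

(* Defs.v *)
From Stdlib Require List.
From mathcomp Require Import all_boot.

Set Implicit Arguments.
Unset Strict Implicit.
Unset Printing Implicit Defensive.

(* First-order logic with equality over L_Q, with de Bruijn indices: the
   variable [Var n] under k quantifiers is bound if n < k, and otherwise it is
   the free variable number n - k. *)

Inductive term : Type :=
| Var of nat
| Zero
| Succ of term
| Add of term & term
| Mul of term & term.

Inductive formula : Type :=
| Eq of term & term
| Bot
| Imp of formula & formula
| All of formula.

Definition Neg (p : formula) : formula := Imp p Bot.
Definition Or (p q : formula) : formula := Imp (Neg p) q.
Definition Ex (p : formula) : formula := Neg (All (Neg p)).

Fixpoint subst_term (s : nat -> term) (t : term) : term :=
  match t with
  | Var n => s n
  | Zero => Zero
  | Succ a => Succ (subst_term s a)
  | Add a b => Add (subst_term s a) (subst_term s b)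
  | Mul a b => Mul (subst_term s a) (subst_term s b)
  end.

Definition shift_term : term -> term := subst_term (fun n => Var n.+1).

Definition scons (t : term) (s : nat -> term) (n : nat) : term :=
  if n is m.+1 then s m else t.

Definition up (s : nat -> term) : nat -> term :=
  scons (Var 0) (fun n => shift_term (s n)).

Fixpoint subst (s : nat -> term) (p : formula) : formula :=
  match p with
  | Eq a b => Eq (subst_term s a) (subst_term s b)
  | Bot => Bot
  | Imp q r => Imp (subst s q) (subst s r)
  | All q => All (subst (up s) q)
  end.

Definition shift : formula -> formula := subst (fun n => Var n.+1).

(* [inst p t] replaces the outermost variable 0 of [p] by [t] and lowers the
   other free variables by one. *)
Definition inst (p : formula) (t : term) : formula := subst (scons t Var) p.

(* Natural deduction for classical first-order logic with equality. *)
Inductive prv : seq formula -> formula -> Prop :=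
| prv_ax G p : List.In p G -> prv G p
| prv_impI G p q : prv (p :: G) q -> prv G (Imp p q)
| prv_impE G p q : prv G (Imp p q) -> prv G p -> prv G q
| prv_raa G p : prv (Neg p :: G) Bot -> prv G p
| prv_allI G p : prv (map shift G) p -> prv G (All p)
| prv_allE G p t : prv G (All p) -> prv G (inst p t)
| prv_eq_refl G t : prv G (Eq t t)
| prv_eq_subst G p t u : prv G (Eq t u) -> prv G (inst p t) -> prv G (inst p u).

Definition consistent (G : seq formula) : Prop := ~ prv G Bot.

Definition Q1 := All (Neg (Eq (Succ (Var 0)) Zero)).
Definition Q2 :=
  All (All (Imp (Eq (Succ (Var 1)) (Succ (Var 0))) (Eq (Var 1) (Var 0)))).
Definition Q3 :=
  All (Or (Eq (Var 0) Zero) (Ex (Eq (Succ (Var 0)) (Var 1)))).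
Definition Q4 := All (Eq (Add (Var 0) Zero) (Var 0)).
Definition Q5 :=
  All (All (Eq (Add (Var 1) (Succ (Var 0))) (Succ (Add (Var 1) (Var 0))))).
Definition Q6 := All (Eq (Mul (Var 0) Zero) Zero).
Definition Q7 :=
  All (All (Eq (Mul (Var 1) (Succ (Var 0)))
               (Add (Mul (Var 1) (Var 0)) (Var 1)))).

Definition Q : seq formula := [:: Q1; Q2; Q3; Q4; Q5; Q6; Q7].

(* A strict upper bound on the variables of a term. *)
Fixpoint term_bound (t : term) : nat :=
  match t with
  | Var n => n.+1
  | Zero => 0
  | Succ a => term_bound a
  | Add a b | Mul a b => maxn (term_bound a) (term_bound b)
  end.

(* The sentence "exists x, t(x) = u(x)": each of [Var 0], ..., [Var n.-1] is
   bound by one of the n quantifiers. *)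
Definition dioph_sentence (t u : term) : formula :=
  iter (maxn (term_bound t) (term_bound u)) Ex (Eq t u).

Definition DQ (t u : term) : Prop := consistent (dioph_sentence t u :: Q).

Record structure : Type := Structure {
  dom :> Type;
  zeroS : dom;
  succS : dom -> dom;
  addS : dom -> dom -> dom;
  mulS : dom -> dom -> dom
}.

Fixpoint eval (M : structure) (e : nat -> M) (t : term) : M :=
  match t with
  | Var n => e n
  | Zero => zeroS M
  | Succ a => succS (eval e a)
  | Add a b => addS (eval e a) (eval e b)
  | Mul a b => mulS (eval e a) (eval e b)
  end.

Definition env_cons (M : structure) (x : M) (e : nat -> M) (n : nat) : M :=
  if n is m.+1 then e m else x.

Fixpoint sat (M : structure) (e : nat -> M) (p : formula) : Prop :=
  match p with
  | Eq a b => eval e a = eval e b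
  | Bot => False
  | Imp q r => sat e q -> sat e r
  | All q => forall x : M, sat (env_cons x e) q
  end.

Definition models (M : structure) (G : seq formula) : Prop :=
  forall p, List.In p G -> forall e : nat -> M, sat e p.

(* Partial recursive functions of k arguments. In [RPrim f g] the first argument
   is the recursion variable, and [g] takes the counter, the previous value and
   the parameters; [RMu f] minimizes over the first argument of [f]. *)
Inductive recfun : nat -> Type :=
| RZero : recfun 0
| RSucc : recfun 1
| RProj k (i : 'I_k) : recfun k
| RComp k m (f : recfun m) (g : 'I_m -> recfun k) : recfun k
| RPrim k (f : recfun k) (g : recfun k.+2) : recfun k.+1
| RMu k (f : recfun k.+1) : recfun k.

(* [reval f v y]: the value of [f] at [v] is defined and equal to [y]. *)
Fixpoint reval k (f : recfun k) : k.-tuple nat -> nat -> Prop :=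
  match f in recfun k return k.-tuple nat -> nat -> Prop with
  | RZero => fun _ y => y = 0
  | RSucc => fun v y => y = (thead v).+1
  | RProj _ i => fun v y => y = tnth v i
  | RComp _ m f g => fun v y =>
      exists w : m.-tuple nat,
        (forall i, reval (g i) v (tnth w i)) /\ reval f w y
  | RPrim _ f g => fun v y =>
      exists h : nat -> nat,
        [/\ reval f [tuple of behead v] (h 0),
            forall i, i < thead v ->
              reval g [tuple of i :: h i :: behead v] (h i.+1)
          & y = h (thead v)]
  | RMu _ f => fun v y =>
      reval f [tuple of y :: v] 0 /\
      forall i, i < y -> exists z, reval f [tuple of i :: v] z.+1
  end.

(* [A] has a (total) recursive characteristic function. *)
Definition recursive_set k (A : k.-tuple nat -> Prop) : Prop :=
  exists f : recfun k,
    forall v, (A v -> reval f v 1) /\ (~ A v -> reval f v 0).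

(* Cantor's pairing function. *)
Definition cpair (m n : nat) : nat := 'C((m + n).+1, 2) + m.

(* Goedel numbering of terms (a bijection onto the natural numbers). *)
Fixpoint term_code (t : term) : nat :=
  match t with
  | Zero => 0
  | Var n => 4 * n + 1
  | Succ a => 4 * term_code a + 2
  | Add a b => 4 * cpair (term_code a) (term_code b) + 3
  | Mul a b => 4 * cpair (term_code a) (term_code b) + 4
  end.

Definition decidable_pairs (A : term -> term -> Prop) : Prop :=
  recursive_set (fun v : 2.-tuple nat =>
    exists t u, v = [tuple term_code t; term_code u] /\ A t u).

(* Main.v *)
Require Import Defs.
From Stdlib Require Import Classical ClassicalEpsilon.
From mathcomp Require Import all_boot all_algebra zify.

Set Implicit Arguments.
Unset Strict Implicit.
Unset Printing Implicit Defensive.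

(** Why solvability in models of Q is decidable.

   In a model of Q the nonstandard elements are closed under predecessor, so
   that a sum with a nonstandard argument is nonstandard, and a product with a
   nonstandard argument is nonstandard unless it is x * 0 = 0 or 0 * y with y
   nonstandard. The axioms only force 0 * y to depend on nothing but the orbit
   of y under the successor; its value is otherwise arbitrary, and this division
   by zero is the only way in which an equation whose value is a numeral can
   escape from finitely many small standard values.

   Hence a term can be evaluated symbolically ([veval]): a value is a numeral,
   or an iterated successor of a formal sum, product or variable, named by a
   natural number. The only data are a [table], which says which of the names of
   variables and of products 0 * y stand for numerals. Then t = u is solvable
   iff [criterion] holds, that is, iff either with the empty table neither side
   is a numeral, or some table gives both sides the same value.

   The criterion suffices ([solution_of_criterion]). If neither side is a
   numeral, then both are infinite at x = oo in the model N + {oo} where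
   0 * oo = oo. Every table is realised by the model [free_model], where the
   names are Z-chains of nonstandard elements.

   It is necessary ([criterion_of_DQ]). Extend Q and t = u to a set which is
   maximal consistent with respect to equations. Membership in it is a
   congruence on terms for which k = a + b splits into numerals and k = a * b
   forces a = 0 or b to be a numeral at most k ([Q_congruence]); for each k
   these are derivable in Q by taking boundedly many predecessors ([refute_add],
   [refute_mul]). The table of all names which are equal to a small numeral in
   the congruence then evaluates correctly every term equal to a small numeral
   ([veval_num]), and if one side is a numeral n under the empty table, then it
   is equal to n in the congruence, and so is the other side.

   The same argument bounds the entries of the table by the numerals that the
   empty table yields, and evaluation looks up names only below a bound computed
   from the terms ([eq_veval]). So only finitely many tables have to be
   searched, and the search is a recursive function of the codes of t and u
   ([decide_DQP], [computable_decide_DQ]). Soundness of the deduction system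
   gives the way back from models to consistency ([DQ_of_solution]). *)

(** * Substitution *)

Lemma subst_term_ext s r t : s =1 r -> subst_term s t = subst_term r t.
Proof. by move=> sr; elim: t => //= [a ->|a -> b ->|a -> b ->]. Qed.

Lemma subst_term_comp s r t :
  subst_term s (subst_term r t) = subst_term (fun n => subst_term s (r n)) t.
Proof. by elim: t => //= [a ->|a -> b ->|a -> b ->]. Qed.

Lemma subst_term_Var t : subst_term Var t = t.
Proof. by elim: t => //= [a ->|a -> b ->|a -> b ->]. Qed.

Lemma subst_term_up_shift s t :
  subst_term (up s) (shift_term t) = shift_term (subst_term s t).
Proof. by rewrite /shift_term !subst_term_comp. Qed.

Lemma subst_shift_term t a : subst_term (scons t Var) (shift_term a) = a.
Proof. by rewrite /shift_term subst_term_comp /= subst_term_Var. Qed.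

Lemma up_ext s r : s =1 r -> up s =1 up r.
Proof. by move=> sr [|n] //=; rewrite sr. Qed.

Lemma subst_ext p : forall s r, s =1 r -> subst s p = subst r p.
Proof.
elim: p => //= [a b|p IHp q IHq|p IHp] s r sr.
- by rewrite !(subst_term_ext _ sr).
- by rewrite (IHp _ r) // (IHq _ r).
- by rewrite (IHp _ _ (up_ext sr)).
Qed.

Lemma subst_comp p : forall s r,
  subst s (subst r p) = subst (fun n => subst_term s (r n)) p.
Proof.
elim: p => //= [a b|p IHp q IHq|p IHp] s r.
- by rewrite !subst_term_comp.
- by rewrite IHp IHq.
- rewrite IHp; congr All; apply: subst_ext => -[|n] //=.
  exact: subst_term_up_shift.
Qed.

Lemma subst_up_shift s p : subst (up s) (shift p) = shift (subst s p).
Proof. by rewrite /shift !subst_comp. Qed.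

Lemma subst_inst s p t :
  subst s (inst p t) = inst (subst (up s) p) (subst_term s t).
Proof.
rewrite /inst !subst_comp; apply: subst_ext => -[|n] //=.
by rewrite subst_shift_term.
Qed.

(** * Natural deduction *)

Definition sub_ctx (G G' : seq formula) : Prop :=
  forall p, List.In p G -> List.In p G'.

Lemma In_map (A B : Type) (f : A -> B) (s : seq A) y :
  List.In y (map f s) <-> exists2 x, List.In x s & y = f x.
Proof.
elim: s => [|x s IHs] /=; first by split=> [|[]].
split=> [[<-|yfs]|[z [<-|zs] yfz]].
- by exists x => //; left.
- by have [z zs ->] := IHs.1 yfs; exists z => //; right.
- by left.
- by right; apply/IHs; exists z.
Qed.

Lemma sub_ctx_map G G' f : sub_ctx G G' -> sub_ctx (map f G) (map f G').
Proof.
by move=> sGG' p /In_map[q qG ->]; apply/In_map; exists q => //; apply: sGG'.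
Qed.

Lemma sub_ctx_cons p G G' : sub_ctx G G' -> sub_ctx (p :: G) (p :: G').
Proof. by move=> sGG' q [->|/sGG'] /=; [left | right]. Qed.

Lemma sub_ctxW p G : sub_ctx G (p :: G).
Proof. by move=> q; right. Qed.

Lemma sub_ctx_trans G2 G1 G3 : sub_ctx G1 G2 -> sub_ctx G2 G3 -> sub_ctx G1 G3.
Proof. by move=> s12 s23 p /s12/s23. Qed.

Lemma prv_weaken G p : prv G p -> forall G', sub_ctx G G' -> prv G' p.
Proof.
elim=> {G p}.
- by move=> G p pG G' sG; apply/prv_ax/sG.
- by move=> G p q _ IH G' sG; apply/prv_impI/IH/sub_ctx_cons.
- by move=> G p q _ IHpq _ IHp G' sG; apply: prv_impE (IHpq _ sG) (IHp _ sG).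
- by move=> G p _ IH G' sG; apply/prv_raa/IH/sub_ctx_cons.
- by move=> G p _ IH G' sG; apply/prv_allI/IH/sub_ctx_map.
- by move=> G p t _ IH G' sG; apply/prv_allE/IH.
- by move=> G t G' _; apply: prv_eq_refl.
- move=> G p t u _ IHe _ IHp G' sG.
  exact: prv_eq_subst (IHe _ sG) (IHp _ sG).
Qed.

Lemma prv_subst G p :
  prv G p -> forall s, prv (map (subst s) G) (subst s p).
Proof.
elim=> {G p}.
- by move=> G p pG s; apply/prv_ax/In_map; exists p.
- by move=> G p q _ IH s; apply: prv_impI (IH s).
- by move=> G p q _ IHpq _ IHp s; apply: prv_impE (IHpq s) (IHp s).
- by move=> G p _ IH s; apply: prv_raa (IH s).
- move=> G p _ IH s; apply: prv_allI.
  have := IH (up s); rewrite -!map_comp.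
  by rewrite (eq_map (g := shift \o subst s)) // => q /=; apply: subst_up_shift.
- by move=> G p t _ IH s; rewrite subst_inst; apply/prv_allE/(IH s).
- by move=> G t s; apply: prv_eq_refl.
- move=> G p t u _ IHe _ IHp s; rewrite subst_inst.
  by apply: prv_eq_subst (IHe s) _; rewrite -subst_inst.
Qed.

Lemma prv_cut G p q : prv G p -> prv (p :: G) q -> prv G q.
Proof. by move=> Gp Gpq; apply: prv_impE Gp; apply: prv_impI. Qed.

Lemma prv_cut_ctx L G G' q : prv (L ++ G) q -> sub_ctx G G' ->
  (forall p, List.In p L -> prv G' p) -> prv G' q.
Proof.
move=> LGq sGG'; have: prv (L ++ G') q.
  apply: (prv_weaken LGq); elim: L {LGq} => //= p L IHL.
  exact: sub_ctx_cons.
elim: L {LGq} q => //= p L IHL q LGq LG'; apply: (prv_cut (p := p)).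
  by apply: LG'; left.
apply: prv_impE (prv_ax _); last by left.
apply: prv_weaken (@sub_ctxW _ _); apply: IHL; first exact: prv_impI.
by move=> r rL; apply: LG'; right.
Qed.

Lemma prv_eq_sym G a b : prv G (Eq a b) -> prv G (Eq b a).
Proof.
move=> ab; have := prv_eq_subst (p := Eq (Var 0) (shift_term a)) ab.
by rewrite /inst /= !subst_shift_term; apply; apply: prv_eq_refl.
Qed.

Lemma prv_eq_trans G b a c :
  prv G (Eq a b) -> prv G (Eq b c) -> prv G (Eq a c).
Proof.
move=> ab bc; have := prv_eq_subst (p := Eq (shift_term a) (Var 0)) bc.
by rewrite /inst /= !subst_shift_term; apply.
Qed.

Lemma prv_eq_Succ G a b : prv G (Eq a b) -> prv G (Eq (Succ a) (Succ b)).
Proof.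
move=> ab.
have := prv_eq_subst (p := Eq (Succ (shift_term a)) (Succ (Var 0))) ab.
by rewrite /inst /= !subst_shift_term; apply; apply: prv_eq_refl.
Qed.

Lemma prv_eq_Add G a a' b b' : prv G (Eq a a') -> prv G (Eq b b') ->
  prv G (Eq (Add a b) (Add a' b')).
Proof.
move=> aa' bb'; have := prv_eq_subst
  (p := Eq (Add (shift_term a) (shift_term b)) (Add (Var 0) (shift_term b))) aa'.
have := prv_eq_subst
  (p := Eq (Add (shift_term a') (shift_term b)) (Add (shift_term a') (Var 0))) bb'.
rewrite /inst /= !subst_shift_term => eb ea.
by apply: prv_eq_trans (ea _) (eb _); apply: prv_eq_refl.
Qed.

Lemma prv_eq_Mul G a a' b b' : prv G (Eq a a') -> prv G (Eq b b') ->
  prv G (Eq (Mul a b) (Mul a' b')).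
Proof.
move=> aa' bb'; have := prv_eq_subst
  (p := Eq (Mul (shift_term a) (shift_term b)) (Mul (Var 0) (shift_term b))) aa'.
have := prv_eq_subst
  (p := Eq (Mul (shift_term a') (shift_term b)) (Mul (shift_term a') (Var 0))) bb'.
rewrite /inst /= !subst_shift_term => eb ea.
by apply: prv_eq_trans (ea _) (eb _); apply: prv_eq_refl.
Qed.

(** * Derivations in Robinson's arithmetic *)

Definition num (n : nat) : term := iter n Succ Zero.

Lemma subst_iter_Succ s n t :
  subst_term s (iter n Succ t) = iter n Succ (subst_term s t).
Proof. by elim: n => //= n ->. Qed.

Lemma shift_num n : shift_term (num n) = num n.
Proof. exact: subst_iter_Succ. Qed.

Lemma sub_ctx_Q_shift G : sub_ctx Q G -> sub_ctx Q (map shift G).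
Proof.
move=> sQ p pQ; apply/In_map; exists p; first exact: sQ.
by case: pQ => [<-|[<-|[<-|[<-|[<-|[<-|[<-|[]]]]]]]].
Qed.

Section Derivations.

Variable G : seq formula.
Hypothesis sQ : sub_ctx Q G.

Let axQ p : List.In p Q -> prv G p.
Proof. by move=> /sQ; apply: prv_ax. Qed.

Lemma prv_Succ_neq0 a : prv G (Eq (Succ a) Zero) -> prv G Bot.
Proof.
have ax : prv G Q1 by apply: axQ; rewrite /=; tauto.
exact: prv_impE (prv_allE a ax).
Qed.

Lemma prv_Succ_inj a b : prv G (Eq (Succ a) (Succ b)) -> prv G (Eq a b).
Proof.
have ax : prv G Q2 by apply: axQ; rewrite /=; tauto.
have := prv_allE b (prv_allE a ax); rewrite /inst /= !subst_shift_term.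
exact: prv_impE.
Qed.

Lemma prv_Add0 a : prv G (Eq (Add a Zero) a).
Proof.
have ax : prv G Q4 by apply: axQ; rewrite /=; tauto.
exact: prv_allE a ax.
Qed.

Lemma prv_AddS a b : prv G (Eq (Add a (Succ b)) (Succ (Add a b))).
Proof.
have ax : prv G Q5 by apply: axQ; rewrite /=; tauto.
by have := prv_allE b (prv_allE a ax); rewrite /inst /= !subst_shift_term.
Qed.

Lemma prv_Mul0 a : prv G (Eq (Mul a Zero) Zero).
Proof.
have ax : prv G Q6 by apply: axQ; rewrite /=; tauto.
exact: prv_allE a ax.
Qed.

Lemma prv_MulS a b : prv G (Eq (Mul a (Succ b)) (Add (Mul a b) a)).
Proof.
have ax : prv G Q7 by apply: axQ; rewrite /=; tauto.
by have := prv_allE b (prv_allE a ax); rewrite /inst /= !subst_shift_term.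
Qed.

(** Case analysis on the axiom Q3 in a refutation: the predecessor is the new
   free variable 0, so that the rest of the context is shifted. *)
Lemma refute_pred a : prv (Eq a Zero :: G) Bot ->
  prv (Eq (Succ (Var 0)) (shift_term a) :: map shift G) Bot -> prv G Bot.
Proof.
move=> r0 rS; have ax : prv G Q3 by apply: axQ; rewrite /=; tauto.
apply: prv_impE (prv_impE (prv_allE a ax) (prv_impI r0)) _.
exact/prv_allI/prv_impI.
Qed.

End Derivations.

Lemma refute_shift L G G' :
  prv (L ++ G) Bot -> sub_ctx (map shift G) G' ->
  (forall p, List.In p L -> prv G' (shift p)) -> prv G' Bot.
Proof.
move=> LG sG' LG'; have := prv_subst LG (fun n => Var n.+1).
rewrite map_cat => LG1; apply: prv_cut_ctx LG1 sG' _ => q /In_map[p pL ->].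
exact: LG'.
Qed.

(** Every predecessor step taken from the right summand lowers the numeral, so
   that at most k + 1 predecessors are taken. *)
Lemma refute_add k : forall G a b, sub_ctx Q G ->
  prv G (Eq (Add a b) (num k)) ->
  (forall i, i <= k ->
     prv ([:: Eq a (num i); Eq b (num (k - i))] ++ G) Bot) ->
  prv G Bot.
Proof.
elim: k => [|k IHk] G a b sQ abk branch; apply: (@refute_pred G sQ b).
- apply: prv_cut_ctx (branch 0 isT) (@sub_ctxW _ _) _ => p [|[|[]]] <-.
    apply: prv_eq_trans (prv_weaken abk (@sub_ctxW _ _)).
    apply: prv_eq_sym; have sQ' := sub_ctx_trans sQ (@sub_ctxW (Eq b Zero) G).
    apply: prv_eq_trans (prv_Add0 sQ' a).
    by apply: prv_eq_Add (prv_eq_refl _ _) _; apply: prv_ax; left.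
  by apply: prv_ax; left.
- set G1 := _ :: _; have sG1 : sub_ctx (map shift G) G1 by apply: sub_ctxW.
  have sQ1 := sub_ctx_trans (sub_ctx_Q_shift sQ) sG1.
  have bS : prv G1 (Eq (Succ (Var 0)) (shift_term b)) by apply: prv_ax; left.
  have := prv_weaken (prv_subst abk (fun n => Var n.+1)) sG1.
  rewrite /= -!/(shift_term _) => e.
  apply: (prv_Succ_neq0 sQ1); apply: prv_eq_trans e.
  apply: prv_eq_trans (prv_eq_sym (prv_AddS sQ1 _ _)) _.
  exact: prv_eq_Add (prv_eq_refl _ _) bS.
- apply: prv_cut_ctx (branch k.+1 (leqnn _)) (@sub_ctxW _ _) _ => p.
  rewrite subnn => -[|[|[]]] <-; last by apply: prv_ax; left.
  apply: prv_eq_trans (prv_weaken abk (@sub_ctxW _ _)).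
  apply: prv_eq_sym; have sQ' := sub_ctx_trans sQ (@sub_ctxW (Eq b Zero) G).
  apply: prv_eq_trans (prv_Add0 sQ' a).
  by apply: prv_eq_Add (prv_eq_refl _ _) _; apply: prv_ax; left.
- set G1 := _ :: _; have sG1 : sub_ctx (map shift G) G1 by apply: sub_ctxW.
  have sQ1 := sub_ctx_trans (sub_ctx_Q_shift sQ) sG1.
  have bS : prv G1 (Eq (Succ (Var 0)) (shift_term b)) by apply: prv_ax; left.
  have := prv_weaken (prv_subst abk (fun n => Var n.+1)) sG1.
  rewrite /= -!/(shift_term _) !shift_num => e.
  apply: (IHk _ (shift_term a) (Var 0)) => // [|i le_ik].
    apply: (prv_Succ_inj sQ1); apply: prv_eq_trans e.
    apply: prv_eq_trans (prv_eq_sym (prv_AddS sQ1 _ _)) _.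
    exact: prv_eq_Add (prv_eq_refl _ _) bS.
  apply: refute_shift (branch i (leqW le_ik)) _ _.
    by move=> p /sG1; do 2!right.
  move=> p [|[|[]]] <-; rewrite /shift /= -!/(shift_term _) shift_num.
    by apply: prv_ax; left.
  rewrite subSn //=; apply: (@prv_eq_trans _ (Succ (Var 0))).
    by apply/prv_eq_sym/(prv_weaken bS) => q; do 2!right.
  by apply/prv_eq_Succ/prv_ax; right; left.
Qed.

(** If a is not 0, then a predecessor step taken from the right factor removes a
   nonzero summand from the product, so that b is bounded by the product. *)
Lemma refute_mul k : forall G a b, sub_ctx Q G ->
  prv G (Eq (Mul a b) (num k)) ->
  prv ([:: Eq a Zero] ++ G) Bot ->
  (forall j, j <= k -> prv ([:: Eq b (num j)] ++ G) Bot) ->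
  prv G Bot.
Proof.
elim/ltn_ind: k => k IHk G a b sQ abk a0 branch.
apply: (@refute_pred G sQ b); first exact: (branch 0).
(* b = S b', so that k = a * b' + a. *)
set G1 := _ :: _; have sG1 : sub_ctx (map shift G) G1 by apply: sub_ctxW.
have sQ1 := sub_ctx_trans (sub_ctx_Q_shift sQ) sG1.
have bS : prv G1 (Eq (Succ (Var 0)) (shift_term b)) by apply: prv_ax; left.
have := prv_weaken (prv_subst abk (fun n => Var n.+1)) sG1.
rewrite /= -!/(shift_term _) !shift_num => e.
have aSk : prv G1 (Eq (Add (Mul (shift_term a) (Var 0)) (shift_term a)) (num k)).
  apply: prv_eq_trans e; apply: prv_eq_trans (prv_eq_sym (prv_MulS sQ1 _ _)) _.
  exact: prv_eq_Mul (prv_eq_refl _ _) bS.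
apply: refute_add aSk _ => // i le_ik /=.
set G2 := _ :: _ :: _.
have sG12 : sub_ctx G1 G2 by move=> p; do 2!right.
have sG2 := sub_ctx_trans sG1 sG12.
have [ge_ki|lt_ik] := leqP k i.
  (* Here a = k - i = 0. *)
  apply: refute_shift a0 sG2 _ => p [|[]] <-.
  by apply: prv_ax; right; left; rewrite /shift /= (eqP ge_ki).
apply: (IHk i lt_ik _ (shift_term a) (Var 0)).
- exact: sub_ctx_trans sQ1 sG12.
- by apply: prv_ax; left.
- apply: refute_shift a0 _ _; first by move=> p /sG2; right.
  by move=> p [|[]] <-; apply: prv_ax; left.
- move=> j le_ji; apply: refute_shift (branch j.+1 (leq_ltn_trans le_ji lt_ik)) _ _.
    by move=> p /sG2; right.
  move=> p [|[]] <-; rewrite /shift /= -!/(shift_term _) shift_num.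
  apply: (@prv_eq_trans _ (Succ (Var 0))).
    by apply/prv_eq_sym/(prv_weaken bS) => q /sG12; right.
  by apply/prv_eq_Succ/prv_ax; left.
Qed.

(** * Soundness *)

Lemma eval_ext (M : structure) (d e : nat -> M) t :
  d =1 e -> eval d t = eval e t.
Proof. by move=> de; elim: t => //= [a ->|a -> b ->|a -> b ->]. Qed.

Lemma eval_subst (M : structure) (e : nat -> M) s t :
  eval e (subst_term s t) = eval (fun n => eval e (s n)) t.
Proof. by elim: t => //= [a ->|a -> b ->|a -> b ->]. Qed.

Lemma sat_ext (M : structure) p : forall d e : nat -> M,
  d =1 e -> sat d p <-> sat e p.
Proof.
elim: p => //= [a b|p IHp q IHq|p IHp] d e de.
- by rewrite !(eval_ext _ de).
- by have := IHp d e de; have := IHq d e de; tauto.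
- have ex x : sat (env_cons x d) p <-> sat (env_cons x e) p.
    by apply: IHp => -[|n] /=.
  by split=> all x; apply/ex/all.
Qed.

Lemma sat_subst (M : structure) p : forall (e : nat -> M) s,
  sat e (subst s p) <-> sat (fun n => eval e (s n)) p.
Proof.
elim: p => //= [a b|p IHp q IHq|p IHp] e s.
- by rewrite !eval_subst.
- by have := IHp e s; have := IHq e s; tauto.
- have ex x : sat (env_cons x e) (subst (up s) p) <->
              sat (env_cons x (fun n => eval e (s n))) p.
    apply: iff_trans (IHp _ _) _; apply: sat_ext => -[|n] //=.
    by rewrite /shift_term eval_subst.
  by split=> all x; apply/ex/all.
Qed.

Lemma sat_inst (M : structure) (e : nat -> M) p t :
  sat e (inst p t) <-> sat (env_cons (eval e t) e) p.
Proof. by rewrite sat_subst; apply: sat_ext => -[|n]. Qed.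

Lemma soundness G p : prv G p -> forall (M : structure) (e : nat -> M),
  (forall q, List.In q G -> sat e q) -> sat e p.
Proof.
elim=> {G p}.
- by move=> G p pG M e; apply.
- by move=> G p q _ IH M e eG /= ep; apply: IH => r [<-|/eG].
- by move=> G p q _ IHpq _ IHp M e eG; apply: (IHpq M e eG); apply: IHp.
- by move=> G p _ IH M e eG; apply: NNPP => np; apply: (IH M e) => r [<-|/eG].
- move=> G p _ IH M e eG x; apply: IH => q /In_map[r /eG er ->].
  by apply/sat_subst; apply: (sat_ext _ _).1 er.
- by move=> G p t _ IH M e eG; apply/sat_inst/(IH M e eG).
- by [].
- move=> G p t u _ IHe _ IHp M e eG; apply/sat_inst.
  by have /= <- := IHe M e eG; apply/sat_inst/IHp.
Qed.

(** The quantifiers are witnessed by the first n values of the environment, and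
   the remaining values are those of the free variables. *)
Lemma sat_iter_Ex (M : structure) (e : nat -> M) p n :
  sat e p -> sat (fun i => e (n + i)) (iter n Ex p).
Proof.
elim: n => [|n IHn] ep //= none; apply: (none (e n)).
by apply: (sat_ext _ _).1 (IHn ep) => -[|i] /=; rewrite ?addn0 ?addSnnS.
Qed.

Lemma DQ_of_solution (M : structure) (e : nat -> M) t u :
  models M Q -> eval e t = eval e u -> DQ t u.
Proof.
move=> MQ etu; set n := maxn (term_bound t) (term_bound u).
move=> /soundness/(_ M (fun i => e (n + i)))/=; apply=> q [<-|/MQ//].
exact: sat_iter_Ex.
Qed.

(** As Q is closed, a refutation of p, whose free variables act as fresh
   constants, also refutes the existential closure of p. *)
Lemma prv_iter_Ex n p : prv (p :: Q) Bot -> prv (iter n Ex p :: Q) Bot.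
Proof.
elim: n => //= n IHn /IHn {IHn}; move: (iter n Ex p) => q rq.
apply: (prv_impE (p := All (Neg q))); first by apply: prv_ax; left.
apply/prv_allI/prv_impI; apply: (prv_weaken rq).
by apply: sub_ctx_cons => r rQ; right; apply: sub_ctx_Q_shift.
Qed.

(** * Pairing and term codes *)

Lemma cpair_lt m n m' n' : m + n < m' + n' -> cpair m n < cpair m' n'.
Proof.
move=> lt; have: 'C((m + n).+2, 2) <= 'C((m' + n').+1, 2) by apply: leq_bin2l.
by rewrite /cpair [X in X <= _]binS bin1; lia.
Qed.

Lemma cpair_inj m n m' n' : cpair m n = cpair m' n' -> m = m' /\ n = n'.
Proof.
have [lt|lt|eq] := ltngtP (m + n) (m' + n').
- by have := cpair_lt lt; lia.
- by have := cpair_lt lt; lia.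
- by rewrite /cpair eq; lia.
Qed.

Lemma cpair_surj z : exists m n, z = cpair m n.
Proof.
elim: z => [|z [m [[|n] ->]]]; first by exists 0, 0.
- exists 0, m.+1; rewrite /cpair [in RHS]binS bin1 !addn0 !add0n; lia.
- exists m.+1, n; rewrite /cpair addSnnS; lia.
Qed.

Lemma leq_cpair m n m' n' : m <= m' -> n <= n' -> cpair m n <= cpair m' n'.
Proof. by move=> le1 le2; apply: leq_add => //; apply: leq_bin2l; lia. Qed.

Lemma cpair_ge m n : m + n <= cpair m n.
Proof. by rewrite /cpair binS bin1; lia. Qed.

Lemma term_code_inj : injective term_code.
Proof.
elim=> [n||a IHa|a IHa b IHb|a IHa b IHb] [n'||a'|a' b'|a' b'] //= e; try lia.
- by congr Var; lia.
- by congr Succ; apply: IHa; lia.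
- by have [|/IHa-> /IHb->] := @cpair_inj (term_code a) (term_code b)
    (term_code a') (term_code b'); first lia.
- by have [|/IHa-> /IHb->] := @cpair_inj (term_code a) (term_code b)
    (term_code a') (term_code b'); first lia.
Qed.

Lemma term_code_surj n : exists t, term_code t = n.
Proof.
elim/ltn_ind: n => -[|n] IHn; first by exists Zero.
have [r [q [eqn lt_r4]]] : exists r q, n = 4 * q + r /\ r < 4.
  by exists (n %% 4), (n %/ 4); split; lia.
have [a [b eq]] := cpair_surj q; have := cpair_ge a b; rewrite -eq => le_q.
case: r lt_r4 eqn => [|[|[|[|]]]] // _ eqn.
- by exists (Var q) => /=; lia.
- by have [|t et] := IHn q; [lia | exists (Succ t) => /=; lia].
- have [|t et] := IHn a; first lia; have [|u eu] := IHn b; first lia.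
  by exists (Add t u); rewrite /= et eu -eq; lia.
- have [|t et] := IHn a; first lia; have [|u eu] := IHn b; first lia.
  by exists (Mul t u); rewrite /= et eu -eq; lia.
Qed.

(** * Symbolic values *)

(** A natural number names an element up to successors. Both arguments of a sum
   or a product are named, the left one being the k-th successor of the element
   named a; the right one matters only up to successors. The name 0 is reserved
   for 0, so that it stands for the numerals. *)
Definition node (a k b : nat) : nat := cpair (cpair a k) b.
Definition add_node (a k b : nat) : nat := 3 * node a k b + 1.
Definition mul_node (a k b : nat) : nat := 3 * node a k b + 2.
Definition var_node (n : nat) : nat := 3 * n + 3.

Lemma node_inj a k b a' k' b' :
  node a k b = node a' k' b' -> [/\ a = a', k = k' & b = b'].
Proof. by move=> /cpair_inj[/cpair_inj[-> ->] ->]. Qed.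

Lemma add_node_neq0 a k b : (add_node a k b == 0) = false.
Proof. by rewrite /add_node addn1. Qed.

Lemma mul_node_neq0 a k b : (mul_node a k b == 0) = false.
Proof. by rewrite /mul_node addn2. Qed.

(** The pair (c, k) is the k-th successor of the element named c. *)
Definition value : Type := (nat * nat)%type.

(** An entry [f c = Some m] declares that the element named c is the numeral m.
   Only the names of variables and of products 0 * b are ever looked up. *)
Definition table : Type := nat -> option nat.

Definition vlookup (f : table) (c : nat) : value :=
  if f c is Some m then (0, m) else (c, 0).

Definition vadd (x y : value) : value :=
  if y.1 == 0 then (x.1, x.2 + y.2) else (add_node x.1 x.2 y.1, y.2).

(** The product of x and the element named b, the only place where division by
   zero is possible; further successors in the right factor add copies of x. *)
Definition vmul_base (f : table) (x : value) (b : nat) : value :=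
  if b == 0 then (0, 0)
  else if x == (0, 0) then vlookup f (mul_node 0 0 b)
  else (mul_node x.1 x.2 b, 0).

Definition vmul (f : table) (x y : value) : value :=
  iter y.2 (vadd^~ x) (vmul_base f x y.1).

Fixpoint veval (f : table) (t : term) : value :=
  match t with
  | Var n => vlookup f (var_node n)
  | Zero => (0, 0)
  | Succ a => ((veval f a).1, (veval f a).2.+1)
  | Add a b => vadd (veval f a) (veval f b)
  | Mul a b => vmul f (veval f a) (veval f b)
  end.

Definition no_table : table := fun=> None.

Definition bounded_table (N : nat) (f : table) : Prop :=
  forall c m, f c = Some m -> m <= N.

(** The parameter A restricts the tables: the criterion is sufficient with
   arbitrary tables, and necessary already with tables whose entries are
   bounded. *)
Definition criterion (A : table -> Prop) (t u : term) : Prop :=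
  ((veval no_table t).1 != 0 /\ (veval no_table u).1 != 0) \/
  exists2 f, A f & veval f t = veval f u.

Definition table_range (t u : term) : nat :=
  (veval no_table t).2 + (veval no_table u).2.

Lemma vadd0 x : vadd x (0, 0) = x.
Proof. by rewrite /vadd /= addn0; case: x. Qed.

Lemma iter_vadd0 n x : iter n (vadd^~ (0, 0)) x = x.
Proof. by elim: n => //= n ->; rewrite vadd0. Qed.

Lemma iter_vadd_num n m k : iter n (vadd^~ (0, m)) (0, k) = (0, k + n * m).
Proof.
by elim: n => [|n IHn] /=; rewrite ?addn0 // IHn /vadd /=; congr pair; lia.
Qed.

(** * Equations that hold in Robinson's arithmetic *)

(** What the necessity of the criterion needs of the equations that hold in a
   model of Q. The last two clauses replace the predecessor axiom: they hold in
   a maximal consistent set of equations even though it need not provide terms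
   for predecessors. *)
Record Q_congruence (E : term -> term -> Prop) : Prop := QCongruence {
  E_refl : forall a, E a a;
  E_sym : forall a b, E a b -> E b a;
  E_trans : forall b a c, E a b -> E b c -> E a c;
  E_Succ : forall a b, E a b -> E (Succ a) (Succ b);
  E_Add : forall a a' b b', E a a' -> E b b' -> E (Add a b) (Add a' b');
  E_Mul : forall a a' b b', E a a' -> E b b' -> E (Mul a b) (Mul a' b');
  E_Succ_neq0 : forall a, ~ E (Succ a) Zero;
  E_Succ_inj : forall a b, E (Succ a) (Succ b) -> E a b;
  E_Add0 : forall a, E (Add a Zero) a;
  E_AddS : forall a b, E (Add a (Succ b)) (Succ (Add a b));
  E_Mul0 : forall a, E (Mul a Zero) Zero;
  E_MulS : forall a b, E (Mul a (Succ b)) (Add (Mul a b) a);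
  E_Add_num : forall a b k, E (Add a b) (num k) ->
    exists i, [/\ i <= k, E a (num i) & E b (num (k - i))];
  E_Mul_num : forall a b k, E (Mul a b) (num k) ->
    E a Zero \/ exists2 j, j <= k & E b (num j)
}.

Section Congruence.

Variable E : term -> term -> Prop.
Hypothesis EQ : Q_congruence E.

Inductive names : nat -> term -> Prop :=
| names_zero : names 0 Zero
| names_var n : names (var_node n) (Var n)
| names_add a k b s t : names a s -> names b t ->
    names (add_node a k b) (Add (iter k Succ s) t)
| names_mul a k b s t : names a s -> names b t ->
    names (mul_node a k b) (Mul (iter k Succ s) t).

Lemma names_fun c s : names c s -> forall t, names c t -> s = t.
Proof.
have inj x y : 3 * x + 1 = 3 * y + 1 \/ 3 * x + 2 = 3 * y + 2 -> x = y by lia.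
elim=> {c s} [|n|a k b s t _ IHs _ IHt|a k b s t _ IHs _ IHt] u r;
  inversion r as [e|n' e|a' k' b' s' t' rs rt e|a' k' b' s' t' rs rt e] => //;
  move: e; rewrite /var_node /add_node /mul_node => e; try lia.
- by congr Var; lia.
- have [|ea <- eb] := @node_inj a' k' b' a k b; first by apply: inj; left; lia.
  by rewrite ea in rs; rewrite eb in rt; rewrite (IHs _ rs) (IHt _ rt).
- have [|ea <- eb] := @node_inj a' k' b' a k b; first by apply: inj; right; lia.
  by rewrite ea in rs; rewrite eb in rt; rewrite (IHs _ rs) (IHt _ rt).
Qed.

Lemma E_num_inj m n : E (num m) (num n) -> m = n.
Proof.
elim: m n => [|m IHm] [|n] //= e.
- by case: (E_Succ_neq0 EQ (E_sym EQ e)).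
- by case: (E_Succ_neq0 EQ e).
- by rewrite (IHm n) //; apply: (E_Succ_inj EQ).
Qed.

Lemma E_iter_Succ k a b : E a b -> E (iter k Succ a) (iter k Succ b).
Proof. by move=> ab; elim: k => //= k; apply: E_Succ. Qed.

Lemma E_Add_iter k a b : E (Add a (iter k Succ b)) (iter k Succ (Add a b)).
Proof.
elim: k => [|k IHk] /=; first exact: E_refl.
exact: E_trans (E_AddS EQ _ _) (E_Succ EQ IHk).
Qed.

Definition represents (x : value) (s : term) : Prop :=
  exists2 y, names x.1 y & E s (iter x.2 Succ y).

Lemma represents_E x s t : E t s -> represents x s -> represents x t.
Proof. by move=> ts [y ry sy]; exists y => //; apply: E_trans sy. Qed.

Lemma represents_num m s : represents (0, m) s -> E s (num m).
Proof. by case=> y /= /names_fun/(_ _ names_zero)->. Qed.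

Lemma represents_vadd x y s t : represents x s -> represents y t ->
  represents (vadd x y) (Add s t).
Proof.
case: x y => a k [b l] [s' /= rs es] [t' /= rt et]; rewrite /vadd /=.
have e : E (Add s t) (iter l Succ (Add (iter k Succ s') t')).
  exact: E_trans (E_Add EQ es et) (E_Add_iter _ _ _).
case: eqP => [b0|_]; last by exists (Add (iter k Succ s') t') => //; apply: names_add.
exists s' => //=; apply: (E_trans EQ) e _.
rewrite b0 in rt; rewrite (names_fun rt names_zero) addnC iterD.
exact: E_iter_Succ (E_Add0 EQ _).
Qed.

(** A sound table makes evaluation correct modulo E. A complete one makes
   evaluation recognise the terms that are equal to numerals up to N. *)
Definition sound_table (f : table) : Prop :=
  forall c m s, f c = Some m -> names c s -> E s (num m).

Definition complete_table (N : nat) (f : table) : Prop :=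
  forall c m s, m <= N -> names c s -> E s (num m) -> f c = Some m.

Lemma represents_vlookup f c s : sound_table f -> names c s ->
  represents (vlookup f c) s.
Proof.
rewrite /vlookup => sf rcs; case fc: (f c) => [m|].
  by exists Zero; [apply: names_zero | apply: sf rcs].
by exists s => //; apply: E_refl.
Qed.

Lemma represents_vmul_base f x s b t :
  sound_table f -> represents x s -> names b t ->
  represents (vmul_base f x b) (Mul s t).
Proof.
move=> sf [s' rs es] rt; rewrite /vmul_base; case: eqP => [b0|_].
  exists Zero => /=; first exact: names_zero.
  by rewrite b0 in rt; rewrite (names_fun rt names_zero); apply: E_Mul0.
apply: (represents_E (E_Mul EQ es (E_refl EQ t))).
case: eqP => [x0|_]; last first.
  by exists (Mul (iter x.2 Succ s') t); [apply: names_mul | apply: E_refl].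
by apply: represents_vlookup => //; rewrite x0 /= in rs *; apply: (@names_mul 0 0).
Qed.

Lemma represents_vmul f x y s t :
  sound_table f -> represents x s -> represents y t ->
  represents (vmul f x y) (Mul s t).
Proof.
move=> sf Rx [t' rt et]; apply: (represents_E (E_Mul EQ (E_refl EQ s) et)).
rewrite /vmul; elim: y.2 => [|l IHl] /=; first exact: represents_vmul_base.
exact: represents_E (E_MulS EQ _ _) (represents_vadd IHl Rx).
Qed.

Lemma represents_veval f t : sound_table f -> represents (veval f t) t.
Proof.
move=> sf; elim: t => [n||a [y ry ay]|a IHa b IHb|a IHa b IHb] /=.
- by apply: represents_vlookup => //; apply: names_var.
- by exists Zero; [apply: names_zero | apply: E_refl].
- by exists y => //; apply: E_Succ.
- exact: represents_vadd.
- exact: represents_vmul.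
Qed.

(** It suffices to see that the value is a numeral, since values are correct and
   distinct numerals are not equal modulo E. A sum equal to k has both summands
   equal to numerals up to k, and so has a product with both factors nonzero. If
   the right factor is 0, so is the product; otherwise the left factor is 0 and
   the product is 0 * b, whose name is in the table. *)
Lemma veval_num N f t k : sound_table f -> complete_table N f ->
  k <= N -> E t (num k) -> veval f t = (0, k).
Proof.
move=> sf cf; suff eval1 k' : k' <= N -> E t (num k') -> (veval f t).1 = 0.
  move=> le_kN e; have e1 := eval1 k le_kN e; have := represents_veval t sf.
  case: (veval f t) e1 => a l /= -> /represents_num e'.
  by rewrite (E_num_inj (E_trans EQ (E_sym EQ e) e')).
move: k' => {}k.
have evalE s j : (veval f s).1 = 0 -> E s (num j) -> veval f s = (0, j).
  move=> e1 e; have := represents_veval s sf.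
  case: (veval f s) e1 => a l /= -> /represents_num e'.
  by rewrite (E_num_inj (E_trans EQ (E_sym EQ e) e')).
elim: t k => [n||a IHa|a IHa b IHb|a IHa b IHb] k le_kN e //=.
- by rewrite /vlookup (cf _ _ _ le_kN (names_var n) e).
- case: k le_kN e => [|k] le_kN e; first by case: (E_Succ_neq0 EQ e).
  exact: IHa (ltnW le_kN) (E_Succ_inj EQ e).
- have [i [le_ik ea eb]] := E_Add_num EQ e.
  by rewrite /vadd (IHb (k - i)) ?(IHa i) //; lia.
have [ea|[j le_jk eb]] := E_Mul_num EQ e.
  (* The successors in b do not change 0 * b. *)
  have ea0 : veval f a = (0, 0) by exact: evalE a 0 (IHa 0 isT ea) ea.
  rewrite ea0 /vmul iter_vadd0 /vmul_base /=; case: eqP => // _.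
  have [y ry ey] := represents_veval b sf.
  have ry0 := @names_mul 0 0 _ _ _ names_zero ry.
  rewrite /vlookup (cf _ _ _ le_kN ry0) //=; apply: E_trans e => //.
  apply: E_trans (E_sym EQ (E_Mul EQ ea ey)) => //.
  elim: (veval f b).2 => [|l IHl] /=; first exact: E_refl.
  apply: E_trans IHl (E_sym EQ _) => //.
  exact: E_trans (E_MulS EQ _ _) (E_Add0 EQ _).
have eb0 := evalE b j (IHb j (leq_trans le_jk le_kN) eb) eb.
rewrite eb0 /vmul /vmul_base /=.
case: j le_jk eb {eb0} => // j le_jk eb.
(* k = a * j + a, so that a is a numeral as well. *)
have eS := E_trans EQ (E_Mul EQ (E_refl EQ a) (E_sym EQ eb)) e.
have [i [le_ik _ ea]] := E_Add_num EQ (E_trans EQ (E_sym EQ (E_MulS EQ a _)) eS).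
have le_N : k - i <= N by lia.
by rewrite (evalE a _ (IHa _ le_N ea) ea) iter_vadd_num.
Qed.

(** The table is well defined because a name stands for at most one term and
   distinct numerals are not equal modulo E. *)
Lemma table_of_congruence N : exists f,
  [/\ bounded_table N f, sound_table f & complete_table N f].
Proof.
pose P c m := m <= N /\ exists2 s, names c s & E s (num m).
pose f c := if excluded_middle_informative (exists m, P c m) is left h
            then Some (proj1_sig (constructive_indefinite_description _ h))
            else None.
have fP c m : f c = Some m -> P c m.
  rewrite /f; case: excluded_middle_informative => // h [<-].
  exact: proj2_sig (constructive_indefinite_description _ h).
have Pf c m m' : P c m -> P c m' -> m = m'.
  move=> [_ [s rs es]] [_ [t rt et]]; rewrite (names_fun rt rs) in et.
  exact: E_num_inj (E_trans EQ (E_sym EQ es) et).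
exists f; split=> [c m /fP[] //|c m s /fP[_ [t rt et]] rs|c m s le_mN rs es].
  by rewrite (names_fun rs rt).
have Pcm : P c m by split=> //; exists s.
case fc: (f c) => [m'|]; first by rewrite (Pf _ _ _ Pcm (fP _ _ fc)).
by move: fc; rewrite /f; case: excluded_middle_informative => // -[]; exists m.
Qed.

(** If one side is a numeral n under the empty table, which is sound, then both
   sides equal n modulo E, and the table of E gives them the value n. *)
Lemma criterion_of_congruence t u :
  E t u -> criterion (bounded_table (table_range t u)) t u.
Proof.
move=> tu; have snone : sound_table no_table by [].
have [f [bf sf cf]] := table_of_congruence (table_range t u).
have num_case s n : represents (0, n) s -> n <= table_range t u ->
    E t s -> E s u -> criterion (bounded_table (table_range t u)) t u.
  move=> /represents_num es le_n ts su; right; exists f => //.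
  rewrite (veval_num sf cf le_n (E_trans EQ ts es)).
  by rewrite (veval_num sf cf le_n (E_trans EQ (E_sym EQ su) es)).
have := represents_veval t snone; have := represents_veval u snone.
case et: (veval no_table t) => [[|a] m]; case eu: (veval no_table u) => [[|b] n].
- move=> Ru _; apply: num_case Ru _ tu (E_refl EQ u).
  by rewrite /table_range eu leq_addl.
- move=> _ Rt; apply: num_case Rt _ (E_refl EQ t) tu.
  by rewrite /table_range et leq_addr.
- move=> Ru _; apply: num_case Ru _ tu (E_refl EQ u).
  by rewrite /table_range eu leq_addl.
- by left; rewrite et eu.
Qed.

End Congruence.

(** * Maximal consistent sets of equations *)

Definition refutes (T : formula -> Prop) (p : formula) : Prop :=
  exists2 G, forall q, List.In q G -> T q & prv (p :: G) Bot.

Definition consistent_set (T : formula -> Prop) : Prop :=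
  forall G, (forall q, List.In q G -> T q) -> consistent G.

Lemma extract_formula (T : formula -> Prop) p G :
  (forall q, List.In q G -> T q \/ q = p) ->
  exists2 G', forall q, List.In q G' -> T q & sub_ctx G (p :: G').
Proof.
elim: G => [|r G IHG] TG; first by exists [::] => // q [].
have [q qG|G' TG' sG] := IHG; first by apply: TG; right.
have [Tr|->] := TG r (or_introl erefl).
- exists (r :: G') => [q [<-//|/TG'//]|q [<-|/sG[<-|qG']]] /=; tauto.
- by exists G' => // q [<-|/sG//]; left.
Qed.

Section Lindenbaum.

Variable G0 : seq formula.
Hypothesis G0_consistent : consistent G0.

(** Lindenbaum's construction, restricted to equations, as no other formulas need
   to be decided in order to obtain a congruence. *)
Fixpoint stage (n : nat) : formula -> Prop :=
  if n is m.+1 then fun p => stage m p \/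
    exists a b, [/\ p = Eq a b, cpair (term_code a) (term_code b) = m &
                    ~ refutes (stage m) p]
  else fun p => List.In p G0.

Definition limit (p : formula) : Prop := exists n, stage n p.

Lemma stage_mono m n p : m <= n -> stage m p -> stage n p.
Proof. by move=> /subnK<-; elim: (n - m) => //= k IHk /IHk; left. Qed.

(** As codes are injective, each stage adds at most one equation. *)
Lemma stage_consistent n : consistent_set (stage n).
Proof.
elim: n => [|n IHn] G TG.
  by move=> rG; apply: G0_consistent; apply: (prv_weaken rG).
have [[p [a [b [ep en np]]]]|old] := classic (exists p a b,
    [/\ p = Eq a b, cpair (term_code a) (term_code b) = n & ~ refutes (stage n) p]).
  have [q qG|G' TG' sG] := @extract_formula (stage n) p G.
    have [|[a' [b' [-> eq _]]]] := TG q qG; first by left.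
    right; rewrite -en in eq.
    by have [/term_code_inj-> /term_code_inj->] := cpair_inj eq.
  by move=> /prv_weaken/(_ _ sG) rG'; apply: np; exists G'.
apply: IHn => q /TG[//|[a [b [-> en nq]]]].
by case: old; exists (Eq a b), a, b.
Qed.

Lemma limit_stage G :
  (forall q, List.In q G -> limit q) ->
  exists n, forall q, List.In q G -> stage n q.
Proof.
elim: G => [|p G IHG] lG; first by exists 0.
have [q qG|m mG] := IHG; first by apply: lG; right.
have [n np] := lG p (or_introl erefl).
exists (maxn m n) => q [<-|/mG]; first by apply: stage_mono np; apply: leq_maxr.
by apply: stage_mono; apply: leq_maxl.
Qed.

Lemma limit_consistent : consistent_set limit.
Proof. by move=> G /limit_stage[n /stage_consistent]. Qed.

Lemma limit_complete a b : limit (Eq a b) \/ refutes limit (Eq a b).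
Proof.
pose n := cpair (term_code a) (term_code b).
have [[G TG rG]|nr] := classic (refutes (stage n) (Eq a b)).
  by right; exists G => // q /TG; exists n.
by left; exists n.+1; right; exists a, b.
Qed.

Definition is_eq (p : formula) : Prop := exists a b, p = Eq a b.

(** If every branch contained an equation outside the limit, then finitely many
   members of the limit would refute all branches, hence refute themselves. *)
Lemma limit_branch n (L : nat -> seq formula) G1 :
  (forall q, List.In q G1 -> limit q) ->
  (forall i q, List.In q (L i) -> is_eq q) ->
  (forall G, sub_ctx G1 G -> (forall i, i < n -> prv (L i ++ G) Bot) ->
     prv G Bot) ->
  exists2 i, i < n & forall q, List.In q (L i) -> limit q.
Proof.
move=> lG1 eqL caseL; apply: NNPP => none.
suff [G lG rG] : exists2 G, forall q, List.In q G -> limit q &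
    sub_ctx G1 G /\ forall i, i < n -> prv (L i ++ G) Bot.
  by case: rG => sG /(caseL _ sG); apply: limit_consistent.
have: forall m, m <= n -> exists2 G, forall q, List.In q G -> limit q &
    sub_ctx G1 G /\ forall i, i < m -> prv (L i ++ G) Bot; last by apply.
elim=> [|m IHm] lt_mn; first by exists G1 => //; split.
have [G lG [sG rG]] := IHm (ltnW lt_mn).
have [q [qL nq]] : exists q, List.In q (L m) /\ ~ limit q.
  apply: NNPP => nex; apply: none; exists m => // q qL.
  by apply: NNPP => nq; apply: nex; exists q.
have [a [b eqq]] := eqL m q qL.
have [//|[Gq lGq rq]] : limit q \/ refutes limit q.
  by rewrite eqq; apply: limit_complete.
exists (Gq ++ G) => [r /List.in_app_iff[/lGq|/lG]//|]; split=> [r /sG rG'|i].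
  by apply/List.in_app_iff; right.
rewrite ltnS leq_eqVlt => /orP[/eqP->|/rG ri].
- apply: (prv_weaken rq) => r [<-|rGq]; apply/List.in_app_iff; first by left.
  by right; apply/List.in_app_iff; left.
- apply: (prv_weaken ri) => r /List.in_app_iff[rL|rG']; apply/List.in_app_iff.
    by left.
  by right; apply/List.in_app_iff; right.
Qed.

Lemma limit_closed G1 a b :
  (forall q, List.In q G1 -> limit q) -> prv G1 (Eq a b) -> limit (Eq a b).
Proof.
move=> lG1 ab; have [||i _] := @limit_branch 1 (fun=> [:: Eq a b]) G1 lG1.
- by move=> i q [<-|[]]; exists a, b.
- by move=> G /(prv_weaken ab)/prv_cut cut /(_ 0 isT)/cut.
- by apply; left.
Qed.

Hypothesis sQ : sub_ctx Q G0.

Let lim0 q : List.In q G0 -> limit q.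
Proof. by exists 0. Qed.

Let lim1 p : limit p -> forall q, List.In q (p :: G0) -> limit q.
Proof. by move=> lp q [<-|/lim0]. Qed.

Let lim2 p r : limit p -> limit r ->
  forall q, List.In q [:: p, r & G0] -> limit q.
Proof. by move=> lp lr q [<-|/(lim1 lr)]. Qed.

Let sQ1 p G : sub_ctx (p :: G0) G -> sub_ctx Q G.
Proof. by move=> sG q /sQ qG0; apply: sG; right. Qed.

(** The limit is consistent and closed under derivations, which gives all clauses
   but the last two; those are case distinctions that the limit decides. *)
Lemma Q_congruence_limit : Q_congruence (fun a b => limit (Eq a b)).
Proof.
have ax0 p G : prv (p :: G) p by apply: prv_ax; left.
have ax1 p r G : prv [:: p, r & G] r by apply: prv_ax; right; left.
have sQ' p : sub_ctx Q (p :: G0) := sub_ctx_trans sQ (@sub_ctxW p G0).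
split.
- by move=> a; apply: limit_closed lim0 (prv_eq_refl _ _).
- by move=> a b /lim1/limit_closed; apply; apply: prv_eq_sym (ax0 _ _).
- move=> b a c /lim2 ab /ab/limit_closed; apply.
  apply: prv_eq_trans (ax0 _ _) (ax1 _ _ _).
- by move=> a b /lim1/limit_closed; apply; apply: prv_eq_Succ (ax0 _ _).
- move=> a a' b b' /lim2 ab /ab/limit_closed; apply.
  apply: prv_eq_Add (ax0 _ _) (ax1 _ _ _).
- move=> a a' b b' /lim2 ab /ab/limit_closed; apply.
  apply: prv_eq_Mul (ax0 _ _) (ax1 _ _ _).
- move=> a /lim1/limit_consistent; apply.
  exact: prv_Succ_neq0 (sQ' _) _ (ax0 _ _).
- move=> a b /lim1/limit_closed; apply.
  exact: prv_Succ_inj (sQ' _) _ _ (ax0 _ _).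
- by move=> a; apply: limit_closed lim0 (prv_Add0 sQ _).
- by move=> a b; apply: limit_closed lim0 (prv_AddS sQ _ _).
- by move=> a; apply: limit_closed lim0 (prv_Mul0 sQ _).
- by move=> a b; apply: limit_closed lim0 (prv_MulS sQ _ _).
- move=> a b k /lim1 labk.
  have [||i le_ik lL] := @limit_branch k.+1
    (fun i => [:: Eq a (num i); Eq b (num (k - i))]) _ labk.
  + by move=> i q [<-|[<-|[]]]; do 2!eexists.
  + move=> G sG rG; apply: refute_add (sQ1 sG) (prv_ax (sG _ _)) rG.
    by left.
  + by exists i; split=> //; apply: lL; [left | right; left].
- move=> a b k /lim1 labk.
  have [||i lt_ik lL] := @limit_branch k.+2
    (fun i => if i is j.+1 then [:: Eq b (num j)] else [:: Eq a Zero]) _ labk.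
  + by move=> [|i] q [<-|[]]; do 2!eexists.
  + move=> G sG rG; apply: refute_mul (sQ1 sG) (prv_ax (sG _ _)) (rG 0 isT) _.
      by left.
    by move=> j; apply: (rG j.+1).
  + case: i lt_ik lL => [|j] lt_jk lL; first by left; apply: lL; left.
    by right; exists j => //; apply: lL; left.
Qed.

End Lindenbaum.

Lemma criterion_of_DQ t u :
  DQ t u -> criterion (bounded_table (table_range t u)) t u.
Proof.
move=> tu; have cons : consistent (Eq t u :: Q).
  by move=> /(@prv_iter_Ex (maxn (term_bound t) (term_bound u)))/tu.
apply: (criterion_of_congruence (Q_congruence_limit cons _)) => [|/=].
  exact: sub_ctxW.
by exists 0; left.
Qed.

(** * Two models of Robinson's arithmetic *)

(** The natural numbers and a fixed point of the successor, which stands for all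
   nonstandard elements; here 0 * oo = oo. *)
Definition black_hole : structure :=
  @Structure (option nat) (Some 0) (omap succn)
    (fun x y => if x is Some m then omap (addn m) y else None)
    (fun x y => match x, y with
                | _, Some 0 => Some 0
                | Some m, Some n => Some (m * n)
                | _, _ => None
                end).

Lemma black_hole_models : models black_hole Q.
Proof.
move=> p pQ e; case: pQ => [<-|[<-|[<-|[<-|[<-|[<-|[<-|[]]]]]]]] /=.
- by case.
- by case=> [m|] [n|] //= [->].
- move=> [[|n]|] nz ne //; first exact: (ne (Some n)).
  exact: (ne None).
- by case=> //= m; rewrite addn0.
- by case=> [m|] [n|] //=; rewrite addnS.
- by case.
- by case=> [m|] [[|n]|] //=; congr Some; lia.
Qed.

Definition collapse (x : value) : black_hole :=
  if x.1 == 0 then Some x.2 else None.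

Lemma collapse_vadd x y : collapse (vadd x y) = addS (collapse x) (collapse y).
Proof.
case: x y => [[|a] k] [[|b] l] //=.
all: by rewrite /collapse /vadd /= add_node_neq0.
Qed.

Lemma collapse_vmul x y :
  collapse (vmul no_table x y) = mulS (collapse x) (collapse y).
Proof.
case: y => [[|b] l].
  elim: l => [|l IHl]; first by case: (collapse x).
  have -> : vmul no_table x (0, l.+1) = vadd (vmul no_table x (0, l)) x by [].
  rewrite collapse_vadd IHl.
  have Q7Q : List.In Q7 Q by do 6!right; left.
  exact/esym/(black_hole_models Q7Q (fun=> None) (collapse x) (Some l)).
have -> : mulS (collapse x) (collapse (b.+1, l)) = None by case: (collapse x) => [[]|].
rewrite /vmul /=; elim: l => [|l IHl] /=; last first.
  by rewrite collapse_vadd IHl.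
by rewrite /vmul_base /=; case: ifP => _; rewrite /collapse /= mul_node_neq0.
Qed.

Lemma eval_black_hole t :
  eval (fun=> None : black_hole) t = collapse (veval no_table t).
Proof.
elim: t => [n||a IHa|a IHa b IHb|a IHa b IHb] //=.
- by rewrite /vlookup /collapse /= /var_node addn3.
- by rewrite IHa /collapse /=; case: ifP.
- by rewrite collapse_vadd -IHa -IHb.
- by rewrite collapse_vmul -IHa -IHb.
Qed.

(** The Z-chains of nonstandard elements. [Node c] is the chain of the symbolic
   values (c, k). If x = (a, k) is nonstandard and c is the name of x * b, then
   the products of x with the elements of the chain of b at the negative
   positions -(i + 1) must satisfy x * S y = x * y + x, so that each of them
   lies on a chain of its own, [Below c k i]. *)
Inductive orbit : Type :=
| Node of nat
| Below of nat & int & nat.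

Inductive element : Type :=
| Std of nat
| Nst of orbit & int.

Definition down (c : nat) (k : int) (i : nat) : orbit :=
  if i is j.+1 then Below c k j else Node c.

(** The auxiliary chains have no names; the default 0 is harmless, as symbolic
   values never lie on them. *)
Definition orbit_code (o : orbit) : nat := if o is Node c then c else 0.

Definition embed (x : value) : element :=
  if x.1 == 0 then Std x.2 else Nst (Node x.1) x.2.

Definition esucc (x : element) : element :=
  match x with
  | Std n => Std n.+1
  | Nst o k => Nst o (k + 1)%R
  end.

(** On the auxiliary chains the sum is fixed by the requirement that adding x =
   (a, k) to x * (b, -(i + 1)) yields x * (b, -i); the subtraction of k accounts
   for the position of x on its chain. Elsewhere the sum with a nonstandard
   right argument lies on the chain of the formal sum. *)
Definition eadd (x y : element) : element :=
  match y with
  | Std n => iter n esucc x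
  | Nst b l =>
    match x with
    | Std m => Nst (Node (add_node 0 m (orbit_code b))) l
    | Nst (Node a) k => Nst (Node (add_node a `|k| (orbit_code b))) l
    | Nst (Below c k i) _ => Nst (down c k i) (l - k)%R
    end
  end.

Definition emul (f : table) (x y : element) : element :=
  match y with
  | Std n => iter n (eadd^~ x) (Std 0)
  | Nst b l =>
    match x with
    | Std 0 => embed (vlookup f (mul_node 0 0 (orbit_code b)))
    | Std m => Nst (Node (mul_node 0 m (orbit_code b))) (Posz m * l)%R
    | Nst a k =>
      let c := mul_node (orbit_code a) `|k| (orbit_code b) in
      match l with
      | Posz l' => iter l' (eadd^~ x) (Nst (Node c) 0)
      | Negz l' => Nst (Below c k l') 0
      end
    end
  end.

Definition free_model (f : table) : structure :=
  Structure (Std 0) esucc eadd (emul f).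

Lemma iter_esucc n o k : iter n esucc (Nst o k) = Nst o (k + Posz n)%R.
Proof.
elim: n => [|n IHn] /=; first by rewrite GRing.addr0.
by rewrite IHn /=; congr Nst; lia.
Qed.

Lemma free_model_models f : models (free_model f) Q.
Proof.
move=> p pQ e; case: pQ => [<-|[<-|[<-|[<-|[<-|[<-|[<-|[]]]]]]]] /=.
- by case.
- by case=> [m|o k] [n|o' k'] //= [->] // /GRing.addIr->.
- move=> [[|n]|o k] nz ne //; first exact: (ne (Std n)).
  by apply: (ne (Nst o (k - 1)%R)); rewrite /= GRing.subrK.
- by [].
- by move=> x [n|o l] //=; case: x => [m|[a|c j i] k] //=; congr Nst; lia.
- by [].
- move=> x [n|b l] //=; case: x => [[|m]|a k] //=.
  + by rewrite iter_esucc; congr Nst; lia.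
  + case: l => [l|[|l]] /=.
    * by rewrite addn1.
    * by rewrite GRing.subrr.
    * by rewrite GRing.subrr subn1.
Qed.

(** Symbolic values form a substructure, as they use neither negative positions
   nor auxiliary chains. *)
Lemma embed_vadd x y : embed (vadd x y) = eadd (embed x) (embed y).
Proof.
case: y => [[|b] l]; last first.
  by case: x => [[|a] k]; rewrite /embed /vadd /= add_node_neq0.
rewrite /vadd /=; case: x => a k; rewrite /embed /=.
case: eqP => _; last by rewrite iter_esucc.
by elim: l => [|l IHl] /=; rewrite ?addn0 // -IHl addnS.
Qed.

Lemma embed_iter_vadd n x z :
  embed (iter n (vadd^~ x) z) = iter n (eadd^~ (embed x)) (embed z).
Proof. by elim: n => //= n IHn; rewrite embed_vadd IHn. Qed.

Lemma embed_vmul f x y : embed (vmul f x y) = emul f (embed x) (embed y).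
Proof.
rewrite /vmul embed_iter_vadd; case: y => [[|b] l] //.
case: x => [[|a] [|k]].
- by rewrite -embed_iter_vadd iter_vadd0.
- rewrite /embed /= mul_node_neq0; elim: l => [|l IHl] /=.
    by rewrite GRing.mulr0.
  by rewrite IHl -iterS iter_esucc; congr Nst; lia.
- by rewrite /embed /= mul_node_neq0.
- by rewrite /embed /= mul_node_neq0.
Qed.

Lemma eval_free_model f t :
  eval (fun n => embed (vlookup f (var_node n)) : free_model f) t =
  embed (veval f t).
Proof.
elim: t => [n||a IHa|a IHa b IHb|a IHa b IHb] //=.
- rewrite IHa /embed /=; case: ifP => //= _; congr Nst; lia.
- by rewrite embed_vadd -IHa -IHb.
- by rewrite embed_vmul -IHa -IHb.
Qed.

Lemma solution_of_criterion A t u : criterion A t u ->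
  exists M : structure, models M Q /\ exists e : nat -> M, eval e t = eval e u.
Proof.
case=> [[/negbTE t1 /negbTE u1]|[f _ etu]].
  exists black_hole; split; first exact: black_hole_models.
  by exists (fun=> None); rewrite !eval_black_hole /collapse t1 u1.
exists (free_model f); split; first exact: free_model_models.
by exists (fun n => embed (vlookup f (var_node n))); rewrite !eval_free_model etu.
Qed.

(** * Computable functions *)

(** The arguments are the values of an environment, so that the variables of an
   expression are shifted by definitional computation. *)
Definition computable (k : nat) (F : (nat -> nat) -> nat) : Prop :=
  exists r : recfun k, forall v : k.-tuple nat, reval r v (F (nth 0 v)).

Definition computable1 (F : nat -> nat) : Prop :=
  computable 1 (fun e => F (e 0)).
Definition computable2 (F : nat -> nat -> nat) : Prop :=
  computable 2 (fun e => F (e 0) (e 1)).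
Definition computable3 (F : nat -> nat -> nat -> nat) : Prop :=
  computable 3 (fun e => F (e 0) (e 1) (e 2)).

Lemma computable_ext k F G : computable k G -> F =1 G -> computable k F.
Proof. by move=> [r rP] FG; exists r => v; rewrite FG. Qed.

Lemma computable_var k i : i < k -> computable k (fun e => e i).
Proof.
by move=> lt_ik; exists (RProj (Ordinal lt_ik)) => v /=; rewrite (tnth_nth 0).
Qed.

Lemma computable_comp k (As : seq ((nat -> nat) -> nat)) F :
  computable (size As) F ->
  (forall i, i < size As -> computable k (nth (fun=> 0) As i)) ->
  computable k (fun e => F (nth 0 [seq A e | A <- As])).
Proof.
move=> [r rP] AsP.
have /fin_all_exists[g gP] (i : 'I_(size As)) : exists g : recfun k,
    forall v : k.-tuple nat, reval g v (nth (fun=> 0) As i (nth 0 v)).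
  exact: AsP.
exists (RComp r g) => v; exists (map_tuple (fun A => A (nth 0 v)) (in_tuple As)).
split; last exact: rP.
by move=> i; rewrite (tnth_nth 0) /= (nth_map (fun=> 0)).
Qed.

Lemma computable_comp1 k F A :
  computable1 F -> computable k A -> computable k (fun e => F (A e)).
Proof. by move=> cF cA; apply: (@computable_comp k [:: A] _ cF) => -[]. Qed.

Lemma computable_comp2 k F A B : computable2 F ->
  computable k A -> computable k B -> computable k (fun e => F (A e) (B e)).
Proof.
by move=> cF cA cB; apply: (@computable_comp k [:: A; B] _ cF) => -[|[]].
Qed.

Lemma computable_comp3 k F A B C : computable3 F ->
  computable k A -> computable k B -> computable k C ->
  computable k (fun e => F (A e) (B e) (C e)).
Proof.
by move=> cF cA cB cC; apply: (@computable_comp k [:: A; B; C] _ cF) => -[|[|[]]].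
Qed.

Lemma computable_zero k : computable k (fun=> 0).
Proof.
have c0 : computable 0 (fun=> 0) by exists RZero.
exact: (@computable_comp k [::] _ c0).
Qed.

Lemma computable_succ k A : computable k A -> computable k (fun e => (A e).+1).
Proof.
apply: (@computable_comp1 k succn); exists RSucc => v /=.
by rewrite /thead (tnth_nth 0).
Qed.

(** The counter and the accumulator become the variables 0 and 1, and the
   variables of the surrounding expression are shifted by two. *)
Lemma computable_iteri k N A (G : nat -> nat -> (nat -> nat) -> nat) :
  computable k N -> computable k A ->
  computable k.+2 (fun e => G (e 0) (e 1) (fun j => e j.+2)) ->
  computable k (fun e => iteri (N e) (fun i x => G i x e) (A e)).
Proof.
move=> [rN NP] [rA AP] [rG GP].
exists (RComp (RPrim rA rG)
  (fun i => if unlift ord0 i is Some j then RProj j else rN)) => v.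
pose n := N (nth 0 v); exists [tuple of n :: v]; split.
  move=> i; case: unliftP => [j|] ->; rewrite (tnth_nth 0) //=.
  by rewrite (tnth_nth 0).
pose h i := iteri i (fun i x => G i x (nth 0 v)) (A (nth 0 v)); exists h.
have behead_v : [tuple of behead [tuple of n :: v]] = v by apply: val_inj.
split=> [|i _|]; first by rewrite behead_v; apply: AP.
  have -> : [tuple of i :: h i :: behead [tuple of n :: v]] =
            [tuple of i :: h i :: v] by apply: val_inj.
  exact: (GP [tuple of i :: h i :: v]).
by rewrite /thead (tnth_nth 0).
Qed.

Lemma computable_iter k N A (G : nat -> (nat -> nat) -> nat) :
  computable k N -> computable k A ->
  computable k.+2 (fun e => G (e 1) (fun j => e j.+2)) ->
  computable k (fun e => iter (N e) (fun x => G x e) (A e)).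
Proof.
move=> cN cA cG; apply: computable_ext (computable_iteri cN cA cG) _ => e.
by elim: (N e) => //= n ->.
Qed.

Lemma computable_add k A B : computable k A -> computable k B ->
  computable k (fun e => A e + B e).
Proof.
apply: computable_comp2; apply: (@computable_ext _ _
  (fun e => iter (e 0) succn (e 1))); last by move=> e; rewrite iter_succn addnC.
by apply: computable_iter; try apply: computable_succ; apply: computable_var.
Qed.

Lemma computable_mul k A B : computable k A -> computable k B ->
  computable k (fun e => A e * B e).
Proof.
apply: computable_comp2; apply: (@computable_ext _ _
  (fun e => iter (e 0) (fun x => e 1 + x) 0)).
  by apply: (computable_iter _ (computable_zero _) (computable_add _ _));
    apply: computable_var.
by move=> e; rewrite iter_addn_0 mulnC.
Qed.

Lemma computable_pred k A : computable k A -> computable k (fun e => (A e).-1).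
Proof.
apply: (@computable_comp1 k predn); apply: (@computable_ext _ _
  (fun e => iteri (e 0) (fun i _ => i) 0)); last by move=> e /=; case: (e 0).
by apply: (computable_iteri _ (computable_zero _)); apply: computable_var.
Qed.

Lemma computable_sub k A B : computable k A -> computable k B ->
  computable k (fun e => A e - B e).
Proof.
apply: computable_comp2; apply: (@computable_ext _ _
  (fun e => iter (e 1) predn (e 0))); last by move=> e; rewrite iter_predn.
by apply: (computable_iter _ _ (computable_pred _)); apply: computable_var.
Qed.

Lemma computable_leq k A B : computable k A -> computable k B ->
  computable k (fun e => A e <= B e).
Proof.
move=> cA cB; apply: (@computable_ext _ _ (fun e => 1 - (A e - B e))).
  apply: computable_sub (computable_sub cA cB).
  exact: computable_succ (computable_zero _).
by move=> e; lia.
Qed.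

Lemma computable_and k (A B : (nat -> nat) -> bool) :
  computable k A -> computable k B -> computable k (fun e => A e && B e).
Proof.
move=> cA cB; apply: (computable_ext (computable_mul cA cB)) => e.
by rewrite mulnb.
Qed.

Lemma computable_neg k (A : (nat -> nat) -> bool) :
  computable k A -> computable k (fun e => ~~ A e).
Proof.
move=> cA; apply: (@computable_ext _ _ (fun e => 1 - A e)).
  exact: computable_sub (computable_succ (computable_zero _)) cA.
by move=> e; case: (A e).
Qed.

Lemma computable_eq k A B : computable k A -> computable k B ->
  computable k (fun e => A e == B e).
Proof.
move=> cA cB; apply: computable_ext
  (computable_and (computable_leq cA cB) (computable_leq cB cA)) _ => e.
by rewrite eqn_leq.
Qed.

Lemma computable_if k (A : (nat -> nat) -> bool) B C : computable k A ->
  computable k B -> computable k C ->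
  computable k (fun e => if A e then B e else C e).
Proof.
move=> cA cB cC; apply: (@computable_ext _ _
  (fun e => A e * B e + ~~ A e * C e)); last by move=> e; case: (A e); lia.
by apply: computable_add; apply: computable_mul => //; apply: computable_neg.
Qed.

Lemma computable_sum k N (F : nat -> (nat -> nat) -> nat) :
  computable k N -> computable k.+2 (fun e => F (e 0) (fun j => e j.+2)) ->
  computable k (fun e => \sum_(0 <= i < N e) F i e).
Proof.
move=> cN cF; apply: (@computable_ext _ _
  (fun e => iteri (N e) (fun i x => x + F i e) 0)).
  apply: (computable_iteri cN (computable_zero _)).
  by apply: computable_add cF; apply: computable_var.
move=> e; elim: (N e) => [|n IHn]; first by rewrite big_geq.
by rewrite big_nat_recr //= IHn.
Qed.

Ltac computable_arith :=
  lazymatch goal with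
  | |- computable _ (fun e => e _) => by apply: computable_var
  | |- computable _ (fun e => 0) => exact: computable_zero
  | |- computable _ (fun e => nat_of_bool (_ && _)) => apply: computable_and
  | |- computable _ (fun e => nat_of_bool (~~ _)) => apply: computable_neg
  | |- computable _ (fun e => nat_of_bool (_ == _)) => apply: computable_eq
  | |- computable _ (fun e => nat_of_bool (_ <= _)) => apply: computable_leq
  | |- computable _ (fun e => if _ then _ else _) => apply: computable_if
  | |- computable _ (fun e => iter _ _ _) => apply: computable_iter
  | |- computable _ (fun e => iteri _ _ _) => apply: computable_iteri
  | |- computable _ (fun e => \sum_(0 <= i < @?N e) (@?F e i)) =>
      apply: computable_sum
  | |- computable _ (fun e => _ - _) => apply: computable_sub
  | |- computable _ (fun e => _ * _) => apply: computable_mul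
  | |- computable _ (fun e => _ + _) => apply: computable_add
  | |- computable _ (fun e => _.-1) => apply: computable_pred
  | |- computable _ (fun e => _.+1) => apply: computable_succ
  end.

Lemma computable_cpair k A B : computable k A -> computable k B ->
  computable k (fun e => cpair (A e) (B e)).
Proof.
apply: computable_comp2; apply: (@computable_ext _ _
  (fun e => (\sum_(0 <= i < (e 0 + e 1).+1) i) + e 0)); last first.
  by move=> e; rewrite /cpair -bin2_sum.
by repeat computable_arith.
Qed.

(** The projections of the pairing, as bounded sums with one nonzero summand. *)
Definition cfst (z : nat) : nat :=
  \sum_(0 <= m < z.+1) \sum_(0 <= n < z.+1) (cpair m n == z) * m.
Definition csnd (z : nat) : nat :=
  \sum_(0 <= m < z.+1) \sum_(0 <= n < z.+1) (cpair m n == z) * n.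

Lemma sum_cpair (F : nat -> nat -> nat) m n z : z = cpair m n ->
  \sum_(0 <= i < z.+1) \sum_(0 <= j < z.+1) (cpair i j == z) * F i j = F m n.
Proof.
move=> ez; have le := cpair_ge m n.
have lt_m : m < z.+1 by lia.
have lt_n : n < z.+1 by lia.
rewrite big_mkord (bigD1 (Ordinal lt_m)) //= big_mkord.
rewrite (bigD1 (Ordinal lt_n)) //=.
rewrite -ez eqxx mul1n !big1 ?addn0 // => [i ne_im|j ne_jn].
  apply: big1 => j _; case: eqP => // e; have [eim _] := cpair_inj (etrans e ez).
  by case/eqP: ne_im; apply: val_inj.
case: eqP => // e; have [_ ejn] := cpair_inj (etrans e ez).
by case/eqP: ne_jn; apply: val_inj.
Qed.

Lemma cfst_cpair m n : cfst (cpair m n) = m.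
Proof. exact: (sum_cpair (fun i _ => i) erefl). Qed.

Lemma csnd_cpair m n : csnd (cpair m n) = n.
Proof. exact: (sum_cpair (fun _ j => j) erefl). Qed.

Lemma computable_cfst k A : computable k A -> computable k (fun e => cfst (A e)).
Proof.
apply: (@computable_comp1 k cfst); rewrite /computable1 /cfst.
by repeat first [computable_arith | apply: computable_cpair].
Qed.

Lemma computable_csnd k A : computable k A -> computable k (fun e => csnd (A e)).
Proof.
apply: (@computable_comp1 k csnd); rewrite /computable1 /csnd.
by repeat first [computable_arith | apply: computable_cpair].
Qed.

Lemma computable_div4 k A : computable k A -> computable k (fun e => A e %/ 4).
Proof.
apply: (@computable_comp1 k (divn^~ 4)); apply: (@computable_ext _ _
  (fun e => \sum_(0 <= i < e 0) (i.+1 * 4 <= e 0))).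
  by repeat computable_arith.
move=> e; have sum_lt q n : \sum_(0 <= i < n) (i < q) = minn n q.
  elim: n => [|n IHn]; first by rewrite big_geq // min0n.
  by rewrite big_nat_recr //= IHn; lia.
rewrite (eq_bigr (fun i => nat_of_bool (i < e 0 %/ 4))) => [|i _].
  by rewrite sum_lt; lia.
by congr nat_of_bool; lia.
Qed.

Ltac computable_step :=
  lazymatch goal with
  | |- computable _ (fun e => cpair _ _) => apply: computable_cpair
  | |- computable _ (fun e => cfst _) => apply: computable_cfst
  | |- computable _ (fun e => csnd _) => apply: computable_csnd
  | |- computable _ (fun e => _ %/ 4) => apply: computable_div4
  | _ => computable_arith
  end.

(** * Recursion on terms *)

Section TermRecursion.

Variables (zero : nat -> nat) (var succ : nat -> nat -> nat).
Variables (add mul : nat -> nat -> nat -> nat).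

Definition look (h n i : nat) : nat := cfst (iter (n.-1 - i) csnd h).

Definition rec_step (p n h : nat) : nat :=
  let q := n.-1 %/ 4 in
  let r := n.-1 - 4 * q in
  if n == 0 then zero p
  else if r == 0 then var p q
  else if r == 1 then succ p (look h n q)
  else if r == 2 then add p (look h n (cfst q)) (look h n (csnd q))
  else mul p (look h n (cfst q)) (look h n (csnd q)).

(** The values at all smaller codes are kept in a list, the latest one first. *)
Definition history (p n : nat) : nat :=
  iteri n (fun i h => cpair (rec_step p i h) h) 0.

Definition code_rec (p n : nat) : nat := rec_step p n (history p n).

Lemma look_history p n i : i < n -> look (history p n) n i = code_rec p i.
Proof.
elim: n => // n IHn; rewrite ltnS leq_eqVlt => /orP[/eqP->|lt_in].
  by rewrite /look /= subnn /= cfst_cpair.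
rewrite -IHn // /look /= (_ : n - i = (n.-1 - i).+1); last lia.
by rewrite iterSr csnd_cpair.
Qed.

Lemma computable_code_rec : computable1 zero -> computable2 var ->
  computable2 succ -> computable3 add -> computable3 mul -> computable2 code_rec.
Proof.
move=> cz cv cs ca cm; have c_step : computable3 rec_step.
  rewrite /computable3 /rec_step /look.
  by repeat first [ apply: (computable_comp1 cz) | apply: (computable_comp2 cv)
    | apply: (computable_comp2 cs) | apply: (computable_comp3 ca)
    | apply: (computable_comp3 cm) | computable_step ].
rewrite /computable2 /code_rec /history.
by repeat first [ apply: (computable_comp3 c_step) | computable_step ].
Qed.

Variable R : nat -> term -> nat.

Hypothesis R_Zero : forall p, R p Zero = zero p.
Hypothesis R_Var : forall p n, R p (Var n) = var p n.
Hypothesis R_Succ : forall p a, R p (Succ a) = succ p (R p a).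
Hypothesis R_Add : forall p a b, R p (Add a b) = add p (R p a) (R p b).
Hypothesis R_Mul : forall p a b, R p (Mul a b) = mul p (R p a) (R p b).

Lemma code_recE p t : code_rec p (term_code t) = R p t.
Proof.
have divE q r n : n = 4 * q + r.+1 -> r < 4 -> n.-1 %/ 4 = q by lia.
elim: t => [n||a IHa|a IHa b IHb|a IHa b IHb].
- rewrite R_Var /code_rec /rec_step (divE n 0) //=.
  by rewrite (_ : 4 * n + 1 == 0 = false); last lia; rewrite (_ : _ - _ = 0); last lia.
- by rewrite R_Zero.
- rewrite R_Succ -IHa [LHS]/code_rec /rec_step.
  rewrite (divE (term_code a) 1) //= look_history; last lia.
  by rewrite addn2 /= (_ : _.+1 - _ = 1); last lia.
- have le := cpair_ge (term_code a) (term_code b).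
  rewrite R_Add -IHa -IHb [LHS]/code_rec /rec_step.
  rewrite (divE (cpair (term_code a) (term_code b)) 2) //=.
  rewrite cfst_cpair csnd_cpair !look_history; try lia.
  by rewrite addn3 /= (_ : _.+2 - _ = 2); last lia.
- have le := cpair_ge (term_code a) (term_code b).
  rewrite R_Mul -IHa -IHb [LHS]/code_rec /rec_step.
  rewrite (divE (cpair (term_code a) (term_code b)) 3) //=.
  rewrite cfst_cpair csnd_cpair !look_history; try lia.
  by rewrite addn4 /= (_ : _.+3 - _ = 3); last lia.
Qed.

End TermRecursion.

(** * Bounds on the tables *)

(** If the components of two values are bounded by x and y, those of their sum
   and product are bounded by the functions below. *)
Definition add_bound (x y : nat) : nat := add_node x x y + x + y.

Definition mul_bound (N x y : nat) : nat :=
  iter y (fun z => add_bound z x) (mul_node x x y + N).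

Fixpoint value_bound (N : nat) (t : term) : nat :=
  match t with
  | Var n => var_node n + N
  | Zero => 0
  | Succ a => (value_bound N a).+1
  | Add a b => add_bound (value_bound N a) (value_bound N b)
  | Mul a b => mul_bound N (value_bound N a) (value_bound N b)
  end.

Definition fits (m : nat) (x : value) : bool := (x.1 <= m) && (x.2 <= m).

Lemma leq_node a k b a' k' b' :
  a <= a' -> k <= k' -> b <= b' -> node a k b <= node a' k' b'.
Proof. by move=> le1 le2 le3; apply: leq_cpair => //; apply: leq_cpair. Qed.

Lemma node_ge a k b : a + k + b <= node a k b.
Proof.
by rewrite /node; have := cpair_ge a k; have := cpair_ge (cpair a k) b; lia.
Qed.

Lemma fits_vadd m n x y : fits m x -> fits n y -> fits (add_bound m n) (vadd x y).
Proof.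
case: x y => a k [b l] /andP[/= le_a le_k] /andP[/= le_b le_l].
have := node_ge m m n; have := leq_node le_a le_k le_b.
by rewrite /vadd /add_bound /add_node /fits; case: ifP => _ /=; lia.
Qed.

Lemma mul_bound_ge N x y : mul_node x x y + N <= mul_bound N x y.
Proof.
rewrite /mul_bound; elim: {2}y => //= n IHn; apply: leq_trans IHn _.
by rewrite /add_bound -addnA -{1}[iter _ _ _]addn0; have := node_ge; lia.
Qed.

Lemma fits_vlookup N f c : bounded_table N f -> fits (c + N) (vlookup f c).
Proof.
by rewrite /vlookup => bf; case fc: (f c) => [m|]; rewrite /fits /= ?leq_addr //;
  have := bf _ _ fc; lia.
Qed.

Lemma fits_vmul N f m n x y : bounded_table N f ->
  fits m x -> fits n y -> fits (mul_bound N m n) (vmul f x y).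
Proof.
move=> bf fx fy; rewrite /vmul /mul_bound; case/andP: (fx) => le_a le_k.
case/andP: fy => le_b le_l.
have fbase : fits (mul_node m m n + N) (vmul_base f x y.1).
  rewrite /vmul_base; case: ifP => // _; case: ifP => _; last first.
    by have := leq_node le_a le_k le_b; rewrite /fits /mul_node /=; lia.
  have := fits_vlookup (mul_node 0 0 y.1) bf.
  by have := leq_node (leq0n m) (leq0n m) le_b; rewrite /fits /mul_node; lia.
set z0 := _ + N in fbase *.
rewrite -(subnK le_l) iterD; set z := iter y.2 _ z0.
have fz : fits z (iter y.2 (vadd^~ x) (vmul_base f x y.1)).
  by rewrite /z; elim: y.2 => //= l IHl; apply: fits_vadd.
elim: (n - y.2) => //= l; rewrite /fits /add_bound; lia.
Qed.

Lemma fits_veval N f t : bounded_table N f -> fits (value_bound N t) (veval f t).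
Proof.
move=> bf; elim: t => [n||a IHa|a IHa b IHb|a IHa b IHb] //=.
- exact: fits_vlookup.
- by move: IHa; rewrite /fits /=; lia.
- exact: fits_vadd.
- exact: fits_vmul.
Qed.

(** Every name that is looked up is a variable or is built from the value of a
   subterm, and the bound dominates both. *)
Lemma eq_veval N f g t : bounded_table N f ->
  (forall c, c <= value_bound N t -> f c = g c) -> veval f t = veval g t.
Proof.
move=> bf; elim: t => [n||a IHa|a IHa b IHb|a IHa b IHb] //= fg.
- by rewrite /vlookup fg // leq_addr.
- by rewrite IHa // => c le; apply: fg; lia.
- by rewrite IHa ?IHb // => c le; apply: fg; rewrite /add_bound; lia.
have le := mul_bound_ge N (value_bound N a) (value_bound N b).
have le' := node_ge (value_bound N a) (value_bound N a) (value_bound N b).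
rewrite -IHa => [|c lec]; last by apply: fg; rewrite /mul_node in le; lia.
rewrite -IHb => [|c lec]; last by apply: fg; rewrite /mul_node in le; lia.
rewrite /vmul; congr iter; rewrite /vmul_base /vlookup fg //.
have /andP[le_b _] := fits_veval b bf.
have := leq_node (leq0n (value_bound N a)) (leq0n (value_bound N a)) le_b.
by rewrite /mul_node in le *; lia.
Qed.

(** * Coded tables and values *)

(** A table is coded as the list of its first entries; the zero list is the
   empty table, as the projections of 0 are 0. *)
Definition table_of (c : nat) : table := fun i =>
  let d := cfst (iter i csnd c) in if d == 0 then None else Some d.-1.

Definition table_bound (n N : nat) : nat := iter n (fun z => cpair N.+1 z) 0.

Lemma table_of0 i : table_of 0 i = None.
Proof.
have c00 : cpair 0 0 = 0 by [].
have csnd0 : iter i csnd 0 = 0.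
  by elim: i => //= i ->; rewrite -{1}c00 csnd_cpair.
by rewrite /table_of csnd0 -{1}c00 cfst_cpair.
Qed.

Lemma table_of_exists N n f : bounded_table N f ->
  exists2 c, c <= table_bound n N & forall i, i < n -> table_of c i = f i.
Proof.
elim: n f => [|n IHn] f bf; first by exists 0.
have [i m|c le_c cP] := IHn (fun i => f i.+1); first exact: bf.
pose d := if f 0 is Some m then m.+1 else 0.
exists (cpair d c) => [|[_|i lt_in]].
- by apply: leq_cpair => //; rewrite /d; case f0: (f 0) => [m|] //; apply: (bf 0).
- by rewrite /table_of /= cfst_cpair /d; case: (f 0).
- by rewrite /table_of iterSr csnd_cpair; apply: cP.
Qed.

Definition vcode (x : value) : nat := cpair x.1 x.2.

Lemma vcode_inj : injective vcode.
Proof. by move=> [a k] [b l] /cpair_inj[/= -> ->]. Qed.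

Lemma cfst_vcode x : cfst (vcode x) = x.1. Proof. exact: cfst_cpair. Qed.
Lemma csnd_vcode x : csnd (vcode x) = x.2. Proof. exact: csnd_cpair. Qed.

(** The symbolic operations are rewritten with arithmetic on codes alone, so that
   their computability can be read off; c is the code of the table. *)
Definition c_lookup (c i : nat) : nat :=
  if cfst (iter i csnd c) == 0 then cpair i 0
  else cpair 0 (cfst (iter i csnd c)).-1.

Definition c_succ (c x : nat) : nat := cpair (cfst x) (csnd x).+1.

Definition c_add (c x y : nat) : nat :=
  if cfst y == 0 then cpair (cfst x) (csnd x + csnd y)
  else cpair (add_node (cfst x) (csnd x) (cfst y)) (csnd y).

Definition c_base (c x b : nat) : nat :=
  if b == 0 then 0
  else if (cfst x == 0) && (csnd x == 0) then c_lookup c (mul_node 0 0 b)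
  else cpair (mul_node (cfst x) (csnd x) b) 0.

Definition c_mul (c x y : nat) : nat :=
  iter (csnd y) (fun z => c_add c z x) (c_base c x (cfst y)).

Lemma c_lookupE c i : c_lookup c i = vcode (vlookup (table_of c) i).
Proof. by rewrite /c_lookup /vlookup /table_of; case: ifP. Qed.

Lemma c_addE c x y : c_add c (vcode x) (vcode y) = vcode (vadd x y).
Proof. by rewrite /c_add !cfst_vcode !csnd_vcode /vadd; case: ifP. Qed.

Lemma c_mulE c x y :
  c_mul c (vcode x) (vcode y) = vcode (vmul (table_of c) x y).
Proof.
rewrite /c_mul !cfst_vcode csnd_vcode /vmul.
elim: y.2 => [|l IHl] /=; last by rewrite IHl c_addE.
rewrite /c_base /vmul_base c_lookupE !cfst_vcode csnd_vcode.
case: ifP => // _; case: x => [a k] /=; rewrite xpair_eqE.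
by case: ifP.
Qed.

Definition eval_code : nat -> nat -> nat :=
  code_rec (fun=> 0) (fun c n => c_lookup c (var_node n)) c_succ c_add c_mul.

Lemma eval_codeE c t :
  eval_code c (term_code t) = vcode (veval (table_of c) t).
Proof.
apply: (code_recE (R := fun c t => vcode (veval (table_of c) t))) => //.
- by move=> p n; rewrite c_lookupE.
- by move=> p a; rewrite /c_succ cfst_vcode csnd_vcode.
- by move=> p a b; rewrite c_addE.
- by move=> p a b; rewrite c_mulE.
Qed.

Definition bound_code : nat -> nat -> nat :=
  code_rec (fun=> 0) (fun N n => var_node n + N) (fun _ x => x.+1)
    (fun _ => add_bound) mul_bound.

Lemma bound_codeE N t : bound_code N (term_code t) = value_bound N t.
Proof. exact: code_recE. Qed.

Lemma computable_eval_code : computable2 eval_code.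
Proof.
apply: computable_code_rec; rewrite /computable1 /computable2 /computable3
  /c_mul /c_base /c_add /c_succ /c_lookup /mul_node /add_node /var_node /node;
  by repeat computable_step.
Qed.

Lemma computable_bound_code : computable2 bound_code.
Proof.
apply: computable_code_rec; rewrite /computable1 /computable2 /computable3
  /mul_bound /add_bound /mul_node /add_node /var_node /node;
  by repeat computable_step.
Qed.

(** * The decision procedure *)

(** The tables to be searched have entries up to N, and evaluation looks up only
   names below the length used here. *)
Definition search_bound (x y : nat) : nat :=
  let N := csnd (eval_code 0 x) + csnd (eval_code 0 y) in
  table_bound (bound_code N x + bound_code N y).+1 N.

(** The disjunction in the criterion, written with conjunction and negation; a
   table with equal values exists iff the sum does not vanish. *)
Definition decide_DQ (x y : nat) : bool :=
  ~~ ((cfst (eval_code 0 x) * cfst (eval_code 0 y) == 0) &&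
      (\sum_(0 <= c < (search_bound x y).+1) (eval_code c x == eval_code c y)
       == 0)).

Lemma computable_decide_DQ : computable2 decide_DQ.
Proof.
rewrite /computable2 /decide_DQ /search_bound /table_bound.
by repeat first [ computable_step
  | apply: (computable_comp2 computable_eval_code)
  | apply: (computable_comp2 computable_bound_code) ].
Qed.

Lemma veval_table_of0 t : veval (table_of 0) t = veval no_table t.
Proof. by apply: (@eq_veval 0) => [c m|c _]; rewrite table_of0. Qed.

(** A positive answer yields a table whose entries need not be bounded, but
   every table provides a solution in a model. *)
Lemma decide_DQP t u : reflect (DQ t u) (decide_DQ (term_code t) (term_code u)).
Proof.
pose N := table_range t u; pose n := (value_bound N t + value_bound N u).+1.
have -> : decide_DQ (term_code t) (term_code u) =
    ((veval no_table t).1 != 0) && ((veval no_table u).1 != 0) ||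
    has (fun c => veval (table_of c) t == veval (table_of c) u)
      (iota 0 (table_bound n N).+1).
  rewrite /decide_DQ /search_bound !eval_codeE !veval_table_of0.
  rewrite !cfst_vcode !csnd_vcode -/(table_range t u) !bound_codeE.
  rewrite muln_eq0 negb_and negb_or sum_nat_seq_eq0 -has_predC /index_iota subn0.
  congr (_ || _); apply: eq_has => c /=.
  by rewrite !eval_codeE (inj_eq vcode_inj); case: (veval _ t == _).
apply: (iffP idP) => [dec|/criterion_of_DQ].
  have crit : criterion (fun=> True) t u.
    case/orP: dec => [/andP[t1 u1]|/hasP[c _ /eqP etu]]; first by left.
    by right; exists (table_of c).
  have [M [MQ [e etu]]] := solution_of_criterion crit.
  exact: DQ_of_solution etu.
case=> [[t1 u1]|[f bf etu]]; first by rewrite t1 u1.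
have [c le_c cP] := table_of_exists n bf.
apply/orP; right; apply/hasP; exists c; first by rewrite mem_iota.
have et : veval f t = veval (table_of c) t.
  by apply: (eq_veval bf) => i le_i; rewrite cP // ltnS;
    apply: leq_trans (leq_addr _ _).
have eu : veval f u = veval (table_of c) u.
  by apply: (eq_veval bf) => i le_i; rewrite cP // ltnS;
    apply: leq_trans (leq_addl _ _).
by rewrite -et -eu etu.
Qed.

Lemma decidable_DQ : decidable_pairs DQ.
Proof.
have [r rP] := computable_decide_DQ; exists r => v.
have [t et] := term_code_surj (nth 0 v 0).
have [u eu] := term_code_surj (nth 0 v 1).
have := rP v; rewrite -et -eu.
have vE : v = [tuple term_code t; term_code u].
  apply: val_inj; rewrite /= et eu.
  by case: v {rP et eu} => -[|x [|y []]].
split=> [[t' [u' [eqv tu']]]|ntu].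
  move: (rP v); rewrite eqv /=.
  by have /decide_DQP-> := tu'.
move: (rP v); rewrite vE /=.
by case: decide_DQP => // tu; case: ntu; exists t, u.
Qed.

Theorem theorem2p14 :
  decidable_pairs DQ /\
  (forall t u : term,
     DQ t u <->
     exists M : structure,
       models M Q /\ exists e : nat -> M, eval e t = eval e u).
Proof.
split=> [|t u]; first exact: decidable_DQ.
split=> [/criterion_of_DQ/solution_of_criterion//|[M [MQ [e etu]]]].
exact: DQ_of_solution etu.
Qed.
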